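(* Let $\vec\alpha=(\alpha_i)_{i\ge1}$, $\vec\beta=(\beta_i)_{i\ge1}$ be sequences of non-negative reals and $\gamma\ge0$ a real with $\gamma+\sum_i\alpha_i+\sum_i\beta_i=1$. For a permutation $\pi$ let $N_i(\pi)$ be its number of $i$-cycles, and let $u,x_1,x_2,\dots$ be indeterminates. 1. Let $E_{n,(\vec\alpha,\vec\beta,\gamma)}$ denote expected value after a $(\vec\alpha,\vec\beta,\gamma)$ shuffle of an $n$ card deck. Then $$\sum_{n\ge0}u^n\,E_{n,(\vec\alpha,\vec\beta,\gamma)}\Big(\prod_ix_i^{N_i}\Big)=\prod_{i,j\ge1}\exp\left(\frac{(u^ix_i)^j}{ij}\sum_{d\mid i}\mu(d)\,\tilde p_{jd}(\vec\alpha,\vec\beta,\gamma)^{i/d}\right).$$ 2. Let $E'_{n,(\vec\alpha,\vec\beta,\gamma)}$ denote expected value after a $(\vec\alpha,\vec\beta,\gamma)$ shuffle of an $n$ card deck followed by reversing the order of the cards. Then $$\sum_{n\ge0}u^n\,E'_{n,(\vec\alpha,\vec\beta,\gamma)}\Big(\prod_ix_i^{N_i}\Big)=\sum_{n\ge0}u^n\,E_{n,(\vec\beta,\vec\alpha,\gamma)}\Big(\prod_ix_i^{N_i}\Big).$$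
   Context: **$(\vec\alpha,\vec\beta,\gamma)$ shuffle.** This is the following probability measure on $S_n$. Choose a word $w_1\cdots w_n$ of integers with independent letters: each letter equals $i>0$ with probability $\alpha_i$, equals $-i<0$ with probability $\beta_i$ ($i\geq 1$), and equals $0$ with probability $\gamma$. Process the distinct letters occurring in the word in increasing order (usual order on $\mathbb Z$), assigning to the positions of each letter the next unused block of consecutive integers from $1,2,\dots,n$ (the block having as many elements as the letter has occurrences). Within the block of a negative letter, the integers are written under its occurrences in decreasing order from left to right. Within the block of a positive letter, they are written in increasing order from left to right. Within the block of the letter $0$, they are written in a uniformly random order (independent of everything else). Then $\pi(k)$ is the integer written under $w_k$. Reversing the order of the cards means multiplying the resulting permutation by the longest element $w_0\in S_n$, $w_0(i)=n+1-i$ (left and right multiplication give conjugate permutations, hence the same cycle type). **Extended power sums.** $\tilde p_1(\vec\alpha,\vec\beta,\gamma)=\gamma+\sum_i\alpha_i+\sum_i\beta_i=1$, and for $m\ge2$, $\tilde p_m(\vec\alpha,\vec\beta,\gamma)=\sum_i\alpha_i^m+(-1)^{m+1}\sum_i\beta_i^m$. $\mu$ is the Möbius function of elementary number theory. The $n=0$ term of each series is $1$. The identities are identities of formal power series in $u$ with coefficients polynomials in the $x_i$. *)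

(* Defs.v *)
From HB Require Import structures.
From mathcomp Require Import all_boot all_order all_algebra all_fingroup.
From mathcomp Require Import finmap.
From mathcomp Require Import all_classical all_reals all_analysis.
(* The notations of monalg clash with those of mathcomp-analysis. *)
From mathcomp.multinomials Require Import -(notations) monalg.

Set Implicit Arguments.
Unset Strict Implicit.
Unset Printing Implicit Defensive.

Import Order.TTheory GRing.Theory Num.Theory.
Import numFieldNormedType.Exports.

Local Open Scope ring_scope.

(* Formal power series in u over A.  A record rather than an alias of nat -> A,
   whose canonical product in mathcomp-analysis is pointwise. *)
Record fps (A : Type) := Fps { coefs : nat -> A }.

HB.instance Definition _ (A : Type) := [isNew for @coefs A].
HB.instance Definition _ (A : choiceType) := [Choice of fps A by <:].

Lemma fpsP (A : Type) (F G : fps A) : coefs F =1 coefs G <-> F = G.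
Proof. by case: F G => [f] [g]; split=> [/funext /= ->|->]. Qed.

Section FpsZmod.
Variable A : zmodType.
Implicit Types F G : fps A.

Definition fps0 : fps A := Fps (fun=> 0).
Definition fps_opp F := Fps (fun n => - coefs F n).
Definition fps_add F G := Fps (fun n => coefs F n + coefs G n).

Fact fps_addA : associative fps_add.
Proof. by move=> F G H; apply/fpsP => n /=; rewrite addrA. Qed.
Fact fps_addC : commutative fps_add.
Proof. by move=> F G; apply/fpsP => n /=; rewrite addrC. Qed.
Fact fps_add0 : left_id fps0 fps_add.
Proof. by move=> F; apply/fpsP => n /=; rewrite add0r. Qed.
Fact fps_addN : left_inverse fps0 fps_opp fps_add.
Proof. by move=> F; apply/fpsP => n /=; rewrite addNr. Qed.

HB.instance Definition _ :=
  GRing.isZmodule.Build (fps A) fps_addA fps_addC fps_add0 fps_addN.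

End FpsZmod.

Section FpsLmod.
Variables (R : nzRingType) (A : lmodType R).
Implicit Types F G : fps A.

Definition fps_scale (c : R) F := Fps (fun n => c *: coefs F n).

Fact fps_scaleA c d F : fps_scale c (fps_scale d F) = fps_scale (c * d) F.
Proof. by apply/fpsP => n /=; rewrite scalerA. Qed.
Fact fps_scale1 : left_id 1 fps_scale.
Proof. by move=> F; apply/fpsP => n /=; rewrite scale1r. Qed.
Fact fps_scaleDr : right_distributive fps_scale +%R.
Proof. by move=> c F G; apply/fpsP => n /=; rewrite scalerDr. Qed.
Fact fps_scaleDl F : {morph fps_scale^~ F : c d / c + d}.
Proof. by move=> c d; apply/fpsP => n /=; rewrite scalerDl. Qed.

HB.instance Definition _ := GRing.Zmodule_isLmodule.Build R (fps A)
  fps_scaleA fps_scale1 fps_scaleDr fps_scaleDl.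

End FpsLmod.

Section FpsRing.
Variable A : comNzRingType.
Implicit Types F G H : fps A.

Definition fpsC (a : A) : fps A := Fps (fun n => a *+ (n == 0)%N).
Definition fpsX : fps A := Fps (fun n => (n == 1)%N%:R).
Definition fps_mul F G : fps A :=
  Fps (fun n => \sum_(i < n.+1) coefs F i * coefs G (n - i)%N).

Definition fps_trunc N F : {poly A} := \poly_(i < N) coefs F i.

Lemma coefs_mul_trunc N F G n : (n < N)%N ->
  coefs (fps_mul F G) n = (fps_trunc N F * fps_trunc N G)`_n.
Proof.
move=> ltnN; rewrite coefM /=; apply: eq_bigr => i _.
by rewrite !coef_poly !(leq_ltn_trans _ ltnN) ?leq_subr -1?ltnS.
Qed.

Fact fps_mulA : associative fps_mul.
Proof.
move=> F G H; apply/fpsP => n; pose T := fps_trunc n.+1.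
transitivity ((T F * (T G * T H))`_n).
  rewrite coefM /=; apply: eq_bigr => i _.
  rewrite coef_poly ltn_ord; congr (_ * _).
  by apply: coefs_mul_trunc; rewrite ltnS leq_subr.
rewrite mulrA coefM /=; apply: eq_bigr => i _.
rewrite [X in _ * X = _]coef_poly ltnS leq_subr; congr (_ * _).
by rewrite -(coefs_mul_trunc F G (ltn_ord i)).
Qed.

Fact fps_mulC : commutative fps_mul.
Proof.
by move=> F G; apply/fpsP => n; rewrite !(coefs_mul_trunc _ _ (ltnSn n)) mulrC.
Qed.

Fact fps_mul1 : left_id (fpsC 1) fps_mul.
Proof.
move=> F; apply/fpsP => n /=; rewrite big_ord_recl /= subn0 mul1r.
by rewrite big1 ?addr0 // => i _; rewrite mulr0n mul0r.
Qed.

Fact fps_mulDl : left_distributive fps_mul +%R.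
Proof.
move=> F G H; apply/fpsP => n /=; rewrite -big_split /=.
by apply: eq_bigr => i _; rewrite mulrDl.
Qed.

Fact fps_1neq0 : fpsC 1 != 0.
Proof. by apply/eqP => /fpsP /(_ 0%N) /= /eqP; rewrite oner_eq0. Qed.

HB.instance Definition _ := GRing.Zmodule_isComNzRing.Build (fps A)
  fps_mulA fps_mulC fps_mul1 fps_mulDl fps_1neq0.

(* Unconditional convergence in the u-adic topology: F is the product of the
   family f when each coefficient of the finite subproducts is eventually equal
   to that of F. *)
Definition is_fps_prod (I : choiceType) (f : I -> fps A) (F : fps A) : Prop :=
  forall n, exists s0 : {fset I}, forall s : {fset I}, (s0 `<=` s)%fset ->
    coefs (\prod_(k <- s) f k) n = coefs F n.

End FpsRing.

(* exp F = sum_k F^k / k!, meaningful when F has zero constant coefficient: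
   then F^k contributes to the coefficient of u^n only if k <= n. *)
Definition fps_exp (R : fieldType) (A : comAlgType R) (F : fps A) : fps A :=
  Fps (fun n => \sum_(k < n.+1) (k`!%:R^-1 : R) *: coefs (F ^+ k) n).

Definition mobius (n : nat) : int :=
  if all (fun p => logn p n == 1)%N (primes n) then (-1) ^+ size (primes n)
  else 0.

(* Real polynomials in the indeterminates x_i, i : nat; x_0 is never used. *)
Notation xpoly R := (malg (cmonom nat) R).

Definition xvar (R : realType) (i : nat) : xpoly R := mkmalgU (ucm i) 1.

Definition num_cycles n (i : nat) (pi : 'S_n) : nat :=
  #|[set c in porbits pi | #|c| == i]|.

Definition cycle_monom (R : realType) n (pi : 'S_n) : xpoly R :=
  \prod_(1 <= i < n.+1) xvar R i ^+ num_cycles i pi.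

Section Shuffle.
Variable R : realType.
(* alpha i and beta i stand for $\alpha_{i+1}$ and $\beta_{i+1}$. *)
Variables (alpha beta : nat -> R) (gamma : R).

Definition letter_prob (a : int) : R :=
  match a with
  | Posz 0 => gamma
  | Posz i.+1 => alpha i
  | Negz i => beta i
  end.

Definition word_prob n (w : {ffun 'I_n -> int}) : R :=
  \prod_k letter_prob (w k).

(* The positions 0, ..., n-1 and the values 0, ..., n-1 of pi stand for
   1, ..., n: the integer written under the k-th letter of w is pi k + 1. *)
Definition in_blocks n (w : {ffun 'I_n -> int}) (pi : 'S_n) : bool :=
  [forall k : 'I_n, let start := #|[set j | w j < w k]| in
             (start <= pi k < start + #|[set j | w j == w k]|)%N].

Definition ordered_in_blocks n (w : {ffun 'I_n -> int}) (pi : 'S_n) : bool :=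
  [forall i : 'I_n, forall j : 'I_n, ((i < j)%N && (w i == w j)) ==>
     ((0 < w i) ==> (pi i < pi j)%N) && ((w i < 0) ==> (pi j < pi i)%N)].

(* Given w, each of the m! orders of the block of the letter 0, of size m,
   has probability 1/m!. *)
Definition fill_prob n (w : {ffun 'I_n -> int}) (pi : 'S_n) : R :=
  if in_blocks w pi && ordered_in_blocks w pi
  then ((#|[set k | w k == 0]|)`!)%:R^-1 else 0.

Definition shuffle_prob n (pi : 'S_n) : R :=
  fine (\esum_(w in [set: {ffun 'I_n -> int}])
          (word_prob w * fill_prob w pi)%:E).

Definition shuffle_mean n (V : lmodType R) (f : 'S_n -> V) : V :=
  \sum_(pi : 'S_n) shuffle_prob pi *: f pi.

Definition longest_perm n : 'S_n := perm (@rev_ord_inj n).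

Definition reversed_shuffle_mean n (V : lmodType R) (f : 'S_n -> V) : V :=
  shuffle_mean (fun pi => f (pi * longest_perm n)%g).

Definition cycle_series : fps (xpoly R) :=
  Fps (fun n => shuffle_mean (@cycle_monom R n)).

Definition reversed_cycle_series : fps (xpoly R) :=
  Fps (fun n => reversed_shuffle_mean (@cycle_monom R n)).

Definition real_series_sum (a : nat -> R) : R := limn (series a).

Definition ext_power_sum (m : nat) : R :=
  if m == 1%N then gamma + real_series_sum alpha + real_series_sum beta
  else real_series_sum (fun i => alpha i ^+ m)
       + (-1) ^+ m.+1 * real_series_sum (fun i => beta i ^+ m).

Definition cycle_factor (i j : nat) : fps (xpoly R) :=
  fps_exp (((i * j)%:R^-1 * \sum_(d <- divisors i)
               (mobius d)%:~R * ext_power_sum (j * d) ^+ (i %/ d))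
           *: (fpsX _ ^+ i * fpsC (xvar R i)) ^+ j).

End Shuffle.

(* Main.v *)
Require Import Defs.
From HB Require Import structures.
From mathcomp Require Import all_boot all_order all_algebra all_fingroup.
From mathcomp Require Import finmap.
From mathcomp Require Import all_classical all_reals all_analysis.
From mathcomp.multinomials Require Import -(notations) monalg.
From mathcomp Require Import zify ring.
Import Order.TTheory GRing.Theory Num.Theory.
Import numFieldNormedType.Exports.
Local Open Scope ring_scope.

Set Implicit Arguments.
Unset Strict Implicit.
Unset Printing Implicit Defensive.

(* Record the letters of a word w read backwards along the cycles of its
   standardization pi: the position k gets the periodic sequence
   w (pi^-1 k), w (pi^-2 k), ...  This sequence increases with k for the
   lexicographic order in which a negative letter reverses what follows, so w and
   pi are determined by the numbers of k over each orbit (necklace) of the shift.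
   Conversely all numbers occur, because the words of length n over q letters and
   the multisets of necklaces of total length n are both q^n in number
   (Gessel-Reutenauer).  On the positions sharing a sequence of period p, pi^-p
   is monotone: it is the identity if the necklace has evenly many negative
   letters, and the order reversal otherwise.  A necklace of weight y contributes
   therefore the factor 1 / (1 - y x_p u^p) or
   (1 + y x_p u^p) / (1 - y^2 x_2p u^2p), and a Moebius inversion computes the
   logarithmic derivative of the product of these factors.
   The letter 0 is the limit N -> oo of N positive letters of probability
   gamma / N, whose occurrences are distinct with probability tending to 1.  The
   recursion expressing the logarithmic derivative passes to this limit and
   determines the series. *)

(** * Monotone permutations and standardization *)

(** The identity for a finite alphabet is proved for arbitrary weights of the letters, not only for
    probabilities. Cutting the alphabet down to the integers of absolute value at most N, whose
    weights need not add up to 1, is therefore harmless, and one limit removes this cut together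
    with the splitting of the letter 0. The inverse of the map from words to multisets of necklaces
    is never constructed: injectivity comes from sorting, surjectivity from comparing cardinals.
    Periodic sequences are represented by words of the fixed length n!, which keeps the type of
    necklaces finite. This type changes with n, so no single product of necklace factors carries all
    the coefficients. The recursion connects the degrees: the product attached to n satisfies it up
    to degree n, where it determines each coefficient from the previous ones. Each instance involves
    finitely many power sums and lower coefficients, polynomially, so that the limit needs only the
    convergence of these numbers. *)

Lemma porbit_dvd (T : finType) (s : {perm T}) x l :
  ((s ^+ l)%g x == x) = (#|porbit s x| %| l)%N.
Proof.
have sp m : (s ^+ (m * #|porbit s x|))%g x = x.
  elim: m => [|m IHm]; first by rewrite mul0n expg0 perm1.
  by rewrite mulSn addnC expgD permM IHm permX iter_porbit.
rewrite {1}(divn_eq l #|porbit s x|) expgD permM sp /dvdn.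
have : (l %% #|porbit s x| < #|porbit s x|)%N.
  by rewrite ltn_mod card_gt0; apply/set0Pn; exists x; apply: porbit_id.
move: (l %% _)%N => [|r] ltr; first by rewrite expg0 perm1 !eqxx.
have := uniq_traject_porbit s x.
move: ltr; case: #|porbit s x| => // p ltr /=.
case/andP=> /negP nx _; apply/negbTE/eqP => rx; apply: nx.
by rewrite -{1}rx permX iterSr; apply/trajectP; exists r.
Qed.

(** If k < s k, monotonicity propagates this to k < s^j k for all j > 0, which is absurd when j is
    the order of s. The same argument for the opposite order excludes s k < k. *)
Lemma increasing_perm_id n (s : 'S_n) (C : {set 'I_n}) :
  {in C, forall k, s k \in C} ->
  {in C &, forall k l : 'I_n, (k < l)%N -> (s k < s l)%N} -> {in C, s =1 id}.
Proof.
move=> sC smono.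
have aux (r : rel nat) : transitive r -> irreflexive r ->
    {in C &, forall k l : 'I_n, r k l -> r (s k) (s l)} ->
    {in C, forall k : 'I_n, ~~ r k (s k)}.
  move=> rT rI rs k kC; apply/negP => rk.
  have rj j : forall k, k \in C -> r k (s k) -> r k ((s ^+ j.+1)%g k).
    elim: j => [|j IHj] {kC rk}k kC rk; first by rewrite expg1.
    rewrite expgS permM; apply: (rT _ _ _ rk).
    by apply: IHj; [apply: sC | apply: rs => //; apply: sC].
  have := rj #[s]%g.-1 k kC rk.
  by rewrite prednK ?order_gt0 // expg_order perm1 rI.
have lt1 := aux ltn ltn_trans ltnn smono.
have gtT : transitive (fun a b : nat => (b < a)%N).
  by move=> a b c ab bc; apply: ltn_trans ab.
have lt2 := aux _ gtT ltnn (fun k l kC lC => smono l k lC kC).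
move=> k kC; apply/val_inj/eqP; rewrite eqn_leq leqNgt (lt1 k kC) leqNgt.
exact: lt2.
Qed.

Section DecreasingPerm.
Variables (n : nat) (s : 'S_n) (C : {set 'I_n}).
Hypothesis sC : {in C, forall k, s k \in C}.
Hypothesis sdec : {in C &, forall k l : 'I_n, (k < l)%N -> (s l < s k)%N}.

Lemma decreasing_permK : {in C, forall k, s (s k) = k}.
Proof.
move=> k kC; rewrite -permM; apply: (@increasing_perm_id _ (s * s)%g C) => //.
  by move=> l lC; rewrite permM; do 2!apply: sC.
by move=> l m lC mC lm; rewrite !permM; apply: sdec; rewrite ?sC ?sdec.
Qed.

(** A decreasing map has at most one fixed point, and the involution s exchanges the points that it
    raises with those that it lowers, so the number of fixed points has the parity of #|C|. *)
Lemma card_fix_decreasing_perm : #|[set k in C | s k == k]| = odd #|C|.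
Proof.
pose U := [set k in C | (k < s k)%N]; pose D := [set k in C | (s k < k)%N].
have UD : s @: U = D.
  apply/setP => k; apply/imsetP/idP => [[l]|]; rewrite !inE.
    by case/andP=> lC ls ->; rewrite sC // decreasing_permK.
  case/andP=> kC ks; exists (s k); last by rewrite decreasing_permK.
  by rewrite !inE sC // decreasing_permK.
have cUD : #|D| = #|U| by rewrite -UD card_imset //; apply: perm_inj.
set F := [set k in C | _].
have CE : #|C| = (#|F| + #|U| + #|D|)%N.
  rewrite -!sum1_card (bigID (fun k => s k == k)) /=.
  rewrite -addnA; congr (_ + _)%N; first by apply: eq_bigl => k; rewrite !inE.
  rewrite (bigID (fun k : 'I_n => (k < s k)%N)) /=.
  congr (_ + _)%N; apply: eq_bigl => k; rewrite !inE -?val_eqE -andbA;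
    by congr (_ && _); case: ltngtP.
have F1 : (#|F| <= 1)%N.
  apply/card_le1_eqP => k l; rewrite !inE => /andP[kC /eqP sk] /andP[lC /eqP sl].
  apply/val_inj; case: (ltngtP k l) => // kl.
    by have := sdec kC lC kl; rewrite sk sl ltnNge ltnW.
  by have := sdec lC kC kl; rewrite sk sl ltnNge ltnW.
have -> : odd #|C| = odd #|F| by rewrite CE cUD -addnA addnn oddD odd_double addbF.
by case: #|F| F1 => [|[]].
Qed.

End DecreasingPerm.

(** The permutation sends k to the number of points with a smaller key. *)
Lemma rank_perm n (kap : 'I_n -> nat) : injective kap ->
  exists pi : 'S_n, forall k l, (kap k < kap l)%N -> (pi k < pi l)%N.
Proof.
move=> kinj; pose U k := [set l | (kap l < kap k)%N].
have Ult k : (#|U k| < n)%N.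
  rewrite -[X in (_ < X)%N]card_ord -cardsT; apply: proper_card.
  by apply/properP; split; [exact: finset.subsetT | exists k; rewrite ?inE ?ltnn].
pose f k := Ordinal (Ult k).
have fmono k l : (kap k < kap l)%N -> (f k < f l)%N.
  move=> kl; apply: proper_card; apply/properP; split.
    by apply/fintype.subsetP => m; rewrite !inE => /ltn_trans; apply.
  by exists k; rewrite !inE ?ltnn.
have finj : injective f.
  move=> k l /(congr1 val) /= fkl; apply: kinj; apply/eqP.
  by case: ltngtP => // /fmono /=; rewrite fkl ltnn.
by exists (perm finj) => k l; rewrite !permE; apply: fmono.
Qed.

(** The standardization of Gessel and Reutenauer for signed letters, as a relation between words and
    permutations. *)
Definition standardizes q (neg : pred 'I_q) n (w : {ffun 'I_n -> 'I_q})
    (pi : 'S_n) : bool :=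
  [forall k, forall l, ((w k < w l)%N ==> (pi k < pi l)%N) &&
    (((k < l)%N && (w k == w l)) ==>
       (if neg (w k) then (pi l < pi k)%N else (pi k < pi l)%N))].

Lemma standardizes_exists q (neg : pred 'I_q) n (w : {ffun 'I_n -> 'I_q}) :
  exists pi : 'S_n, standardizes neg w pi.
Proof.
(* The key is the pair of letter and position written in base n, with the position reversed under a
   negative letter. *)
pose r (k : 'I_n) : 'I_n := if neg (w k) then rev_ord k else k.
pose kap k := (w k * n + r k)%N.
have kap_lt k l : (w k < w l)%N -> (kap k < kap l)%N.
  move=> kl; apply: (@leq_trans ((w k).+1 * n)%N).
    by rewrite mulSnr ltn_add2l ltn_ord.
  by apply: leq_trans (leq_addr _ _); rewrite leq_mul2r kl orbT.
have kinj : injective kap.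
  move=> k l kl; have wkl : w k = w l.
    by apply/val_inj; case: (ltngtP (w k) (w l)) => // /kap_lt; rewrite kl ltnn.
  move/eqP: kl; rewrite /kap /r wkl eqn_add2l => /eqP/val_inj.
  by case: (neg _) => // /rev_ord_inj.
have [pi piP] := rank_perm kinj; exists pi.
apply/forallP => k; apply/forallP => l; apply/andP; split.
  by apply/implyP => /kap_lt/piP.
apply/implyP => /andP[kl /eqP wkl]; case: ifP => negk; apply: piP;
  rewrite /kap /r -wkl negk ltn_add2l //=.
by rewrite ltn_sub2l // (leq_ltn_trans kl).
Qed.

(** * Periodic words and the signed lexicographic order *)

(** The lists of values of f and g are both sorted and have the same multiplicities, hence are
    equal. *)
Lemma monotone_fibers_eq n (T : eqType) (r : rel T) (f g : 'I_n -> T) :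
  transitive r -> antisymmetric r ->
  (forall k l : 'I_n, (k < l)%N -> r (f k) (f l)) ->
  (forall k l : 'I_n, (k < l)%N -> r (g k) (g l)) ->
  (forall x, #|[set k | f k == x]| = #|[set k | g k == x]|) -> f =1 g.
Proof.
move=> rT rA fr gr fg.
have srt (h : 'I_n -> T) : (forall k l : 'I_n, (k < l)%N -> r (h k) (h l)) ->
    sorted r (codom h).
  move=> hr; apply: (@homo_sorted _ _ h (relpre val ltn)) => //.
  by rewrite -sorted_map val_enum_ord iota_ltn_sorted.
have cnt (h : 'I_n -> T) x : count_mem x (codom h) = #|[set k | h k == x]|.
  by rewrite cardsE cardE /enum_mem size_filter count_map enumT; apply: eq_count.
have /(sorted_eq rT rA (srt f fr) (srt g gr)) fgE : perm_eq (codom f) (codom g).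
  by apply/allP => x _ /=; rewrite !cnt fg.
move=> k; move/eq_in_map: fgE => /(_ k); apply; exact: mem_enum.
Qed.

Section CyclicWords.
Variables (q L : nat).

(* Words with letters in 'I_q whose positions are read modulo L.+1. *)
Definition cword := {ffun 'I_L.+1 -> 'I_q}.

Definition letter (x : cword) (t : nat) : 'I_q := x (inZp t).

Definition cword_of (f : nat -> 'I_q) : cword := [ffun j : 'I_L.+1 => f j].

Lemma letter_inj x y : letter x =1 letter y -> x = y.
Proof. by move=> xy; apply/ffunP => j; rewrite -[j]valZpK; apply: xy. Qed.

Lemma letter_mod x t : letter x (t %% L.+1)%N = letter x t.
Proof. by congr (x _); apply: val_inj; rewrite /= modn_mod. Qed.

Lemma periodic_mod (T : Type) (f : nat -> T) m :
  (forall t, f (t + m)%N = f t) -> forall t, f (t %% m)%N = f t.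
Proof.
move=> fm t; rewrite {2}(divn_eq t m) addnC.
elim: (t %/ m)%N => [|d IHd]; first by rewrite mul0n addn0.
by rewrite mulSnr addnA fm.
Qed.

Lemma letter_cword_of f :
  (forall t, f (t + L.+1)%N = f t) -> letter (cword_of f) =1 f.
Proof. by move=> fL t; rewrite /letter ffunE /= periodic_mod. Qed.

Definition cshift_fun (x : cword) : cword := cword_of (fun t => letter x t.+1).

Lemma letter_cshift_fun x t : letter (cshift_fun x) t = letter x t.+1.
Proof.
rewrite letter_cword_of // => s; rewrite -addSn -letter_mod modnDr.
exact: letter_mod.
Qed.

Lemma cshift_fun_inj : injective cshift_fun.
Proof.
move=> x y xy; apply: letter_inj => t.
rewrite -letter_mod -modnDr letter_mod -[RHS]letter_mod -modnDr letter_mod.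
by rewrite addnS -!letter_cshift_fun xy.
Qed.

Definition cshift : {perm cword} := perm cshift_fun_inj.

Lemma letter_cshift x l t : letter ((cshift ^+ l)%g x) t = letter x (t + l)%N.
Proof.
elim: l t => [|l IHl] t; first by rewrite expg0 perm1 addn0.
by rewrite expgSr permM permE letter_cshift_fun IHl addSnnS.
Qed.

Lemma letter_fix x l : ((cshift ^+ l)%g x == x) ->
  forall t, letter x (t + l)%N = letter x t.
Proof. by move=> /eqP xl t; rewrite -letter_cshift xl. Qed.

Lemma cshift_fixP x l :
  (forall t, letter x (t + l)%N = letter x t) -> (cshift ^+ l)%g x == x.
Proof. by move=> xl; apply/eqP/letter_inj => t; rewrite letter_cshift. Qed.

(** Since l divides the length, a word fixed by the l-th shift amounts to a free choice of its first
    l letters. *)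
Lemma sum_cshift_fix (R : comNzRingType) (c : 'I_q -> R) l :
  (0 < l)%N -> (l %| L.+1)%N ->
  \sum_(x | (cshift ^+ l)%g x == x) \prod_(t < l) c (letter x t)
  = (\sum_a c a) ^+ l.
Proof.
case: l => // l _ lL.
have -> : (\sum_a c a) ^+ l.+1 = \prod_(t < l.+1) \sum_a c a.
  by rewrite prodr_const card_ord.
rewrite bigA_distr_bigA /=.
pose h (f : {ffun 'I_l.+1 -> 'I_q}) := cword_of (fun t => f (inZp t)).
have hE f t : letter (h f) t = f (inZp t).
  rewrite letter_cword_of // => s; congr (f _); apply: val_inj => /=.
  by rewrite -modnDmr; move: lL; rewrite /dvdn => /eqP->; rewrite addn0.
rewrite (reindex h); last first.
  exists (fun x => [ffun j : 'I_l.+1 => letter x j]) => [f _|x].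
    by apply/ffunP => j; rewrite ffunE hE valZpK.
  rewrite inE => /letter_fix xl; apply: letter_inj => t; rewrite hE ffunE /=.
  exact: periodic_mod.
apply: eq_big => [f|f _]; last by apply: eq_bigr => t _; rewrite hE valZpK.
apply: cshift_fixP => t; rewrite !hE; congr (f _); apply: val_inj => /=.
by rewrite modnDr.
Qed.

End CyclicWords.

Section SignedLex.
Variables (q : nat) (neg : pred 'I_q).

(* Lexicographic order in which a negative letter reverses the comparison of
   what follows it; the comparison is globally reversed when b is true. *)
Fixpoint slex (b : bool) (s t : seq 'I_q) : bool :=
  match s, t with
  | a :: s', c :: t' =>
      if a == c then slex (b (+) neg a) s' t'
      else if b then (c < a)%N else (a < c)%N
  | _, _ => true
  end.

Lemma slex_flip b s t : size s = size t -> slex (~~ b) s t = slex b t s.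
Proof.
elim: s t b => [|a s IHs] [|c t] b //= [st].
rewrite [c == a]eq_sym; case: eqVneq => [->|_]; last by case: b.
by rewrite addNb IHs.
Qed.

(** The comparison returns true by default once a list is exhausted, whence the hypothesis on the
    sizes. *)
Lemma slex_anti b s t : size s = size t -> slex b s t -> slex b t s -> s = t.
Proof.
elim: s t b => [|a s IHs] [|c t] b //= [st].
rewrite [c == a]eq_sym; case: eqVneq => [<-|_].
  by move=> s1 s2; rewrite (IHs _ _ st s1 s2).
by case: b; case: ltngtP.
Qed.

Lemma slex_trans b s t u : size s = size t -> size t = size u ->
  slex b s t -> slex b t u -> slex b s u.
Proof.
elim: s t u b => [|a s IHs] [|c t] [|d u] b //= [st] [tu].
case: (eqVneq a c) => [<-|ac]; case: eqVneq => [cd|cd].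
- exact: IHs.
- by [].
- by rewrite -cd (negbTE ac).
case: b; case: (eqVneq a d) cd ac => [->|ad] cd ac.
- by move=> h1 h2; have := ltn_trans h1 h2; rewrite ltnn.
- by move=> h1 h2; apply: ltn_trans h1.
- by move=> h1 h2; have := ltn_trans h1 h2; rewrite ltnn.
- by move=> h1 h2; apply: ltn_trans h2.
Qed.

End SignedLex.

Section CwordOrder.
Variables (q : nat) (neg : pred 'I_q) (L : nat).

Definition cword_seq (x : cword q L) := [seq letter x t | t <- iota 0 L.+1].

Lemma cword_seq_inj : injective cword_seq.
Proof.
move=> x y /eq_in_map xy; apply: letter_inj => t.
rewrite -letter_mod -[RHS]letter_mod; apply: xy.
by rewrite mem_iota add0n ltn_mod.
Qed.

Definition cword_le : rel (cword q L) :=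
  fun x y => slex neg false (cword_seq x) (cword_seq y).

Lemma size_cword_seq x : size (cword_seq x) = L.+1.
Proof. by rewrite size_map size_iota. Qed.

Lemma cword_le_anti : antisymmetric cword_le.
Proof.
move=> x y /andP[xy yx]; apply: cword_seq_inj.
by apply: slex_anti xy yx; rewrite !size_cword_seq.
Qed.

Lemma cword_le_trans : transitive cword_le.
Proof. by move=> y x z; apply: slex_trans; rewrite !size_cword_seq. Qed.

End CwordOrder.

(** * Itineraries of positions along the cycles *)

Section Itinerary.
Variables (q : nat) (neg : pred 'I_q) (n : nat).

(* One less than n!, a multiple of all cycle lengths of permutations of 'I_n. *)
Definition itin_period := (n`!).-1.

Lemma itin_periodE : itin_period.+1 = n`!.
Proof. by rewrite prednK // fact_gt0. Qed.

Section OneWord.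
Variables (w : {ffun 'I_n -> 'I_q}) (pi : 'S_n).
Let s := (pi^-1)%g.

(** The first letter read is the one at [s k], not at k: pi sorts the positions by letter, so that
    it is [w (s k)] that increases with k. *)
Definition itinerary (k : 'I_n) : cword q itin_period :=
  cword_of itin_period (fun t => w ((s ^+ t.+1)%g k)).

(** The order of pi divides n!, so the sequence is n!-periodic and nothing is lost by keeping n!
    letters. *)
Lemma letter_itinerary k t : letter (itinerary k) t = w ((s ^+ t.+1)%g k).
Proof.
rewrite letter_cword_of // => {}t; rewrite itin_periodE -addSn expgD.
suff -> : (s ^+ n`! = 1)%g by rewrite mulg1.
have /dvdnP[m ->] : (#[s]%g %| n`!)%N by rewrite -card_Sn -cardsT cardSg ?finset.subsetT.
by rewrite mulnC expgM expg_order expg1n.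
Qed.

Lemma itinerary_perm k : itinerary (s k) = cshift q itin_period (itinerary k).
Proof.
apply: letter_inj => t; rewrite -[cshift _ _]expg1 letter_cshift.
by rewrite !letter_itinerary -permM -expgS addn1.
Qed.

Lemma itinerary_expg k t :
  itinerary ((s ^+ t)%g k) = (cshift q itin_period ^+ t)%g (itinerary k).
Proof.
elim: t => [|t IHt]; first by rewrite !expg0 !perm1.
by rewrite !expgSr !permM itinerary_perm IHt.
Qed.

Hypothesis wpi : standardizes neg w pi.

Lemma stdP k l :
  ((w k < w l)%N -> (pi k < pi l)%N) /\
  ((k < l)%N -> w k = w l ->
     if neg (w k) then (pi l < pi k)%N else (pi k < pi l)%N).
Proof.
have /andP[/implyP h1 /implyP h2] := forallP (forallP wpi k) l.
by split=> // kl /eqP wkl; apply: h2; rewrite kl.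
Qed.

Lemma std_letter_le (k l : 'I_n) : (k < l)%N -> (w (s k) <= w (s l))%N.
Proof.
move=> kl; rewrite leqNgt; apply/negP => /(proj1 (stdP _ _)).
by rewrite !permKV ltnNge ltnW.
Qed.

Lemma std_letter_eq (k l : 'I_n) : (k < l)%N -> w (s k) = w (s l) ->
  if neg (w (s k)) then (s l < s k)%N else (s k < s l)%N.
Proof.
move=> kl wkl; case: (ltngtP (s k) (s l)) => sl.
- by have := proj2 (stdP _ _) sl wkl; case: ifP; rewrite // !permKV ltnNge ltnW.
- have := proj2 (stdP _ _) sl (esym wkl); rewrite wkl.
  by case: ifP; rewrite // !permKV ltnNge ltnW.
- by move/val_inj/perm_inj: sl kl => ->; rewrite ltnn.
Qed.

(** Equal first letters leave s k and s l in the order of k and l, or exchange this order if the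
    letter is negative; the flip of the comparison in [slex] absorbs the exchange. The induction is
    on the number N of letters compared, for all k and l. *)
Lemma itinerary_le (k l : 'I_n) :
  (k < l)%N -> cword_le neg (itinerary k) (itinerary l).
Proof.
rewrite /cword_le /cword_seq; set N := itin_period.+1.
have E m : [seq letter (itinerary m) t | t <- iota 0 N]
           = [seq w ((s ^+ t.+1)%g m) | t <- iota 0 N].
  by apply: eq_map => t; apply: letter_itinerary.
rewrite !E {E}; elim: N k l => [|N IHN] k l kl //=.
rewrite expg1 -[1%N]addn0 !iotaDl -!map_comp.
have E m : [seq w ((s ^+ t.+1)%g (s m)) | t <- iota 0 N]
    = [seq ((fun t => w ((s ^+ t.+1)%g m)) \o addn 1) t | t <- iota 0 N].
  by apply: eq_map => t /=; rewrite -permM -expgS add1n.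
rewrite -!E {E}; case: eqVneq => [wkl|wkl].
  have := std_letter_eq kl wkl; case: (neg _) => /= /IHN //.
  by rewrite -slex_flip // !size_map.
by rewrite ltn_neqAle wkl std_letter_le.
Qed.

(** Points with the same itinerary read the same letter at every step, and each application of s
    keeps or reverses their order according to its sign. *)
Lemma itinerary_fibre_mono (k l : 'I_n) t :
  itinerary k = itinerary l -> (k < l)%N ->
  if odd (\sum_(r < t) neg (letter (itinerary k) r))
  then ((s ^+ t)%g l < (s ^+ t)%g k)%N else ((s ^+ t)%g k < (s ^+ t)%g l)%N.
Proof.
move=> ikl kl; elim: t => [|t]; first by rewrite big_ord0 !expg0 !perm1.
rewrite big_ord_recr /= oddD oddb !expgSr !permM letter_itinerary expgSr permM.
set k' := (s ^+ t)%g k; set l' := (s ^+ t)%g l.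
have wkl : w (s k') = w (s l').
  by rewrite /k' /l' -!permM -expgSr -!letter_itinerary ikl.
case: (odd _) => /= lt.
  by have := std_letter_eq lt (esym wkl); rewrite wkl; case: (neg _).
by have := std_letter_eq lt wkl; case: (neg _).
Qed.

End OneWord.

(** Itineraries increase with the position, so the counts determine them. Then t = pi'^-1 * pi
    preserves each fibre of the itinerary. There pi^-1 and pi'^-1 are monotone in the same
    direction, given by the sign of the first letter, so t is increasing and hence the identity. The
    first letters finally give back w. *)
Lemma standardizes_itinerary_inj w w' pi pi' :
  standardizes neg w pi -> standardizes neg w' pi' ->
  (forall x, #|[set k | itinerary w pi k == x]|
             = #|[set k | itinerary w' pi' k == x]|) ->
  w = w' /\ pi = pi'.
Proof.
move=> wpi wpi' cnt.
have iE : itinerary w pi =1 itinerary w' pi'.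
  apply: monotone_fibers_eq cnt; [exact: cword_le_trans | |
    exact: itinerary_le wpi | exact: itinerary_le wpi'].
  exact: cword_le_anti.
have mono w0 pi0 (wpi0 : standardizes neg w0 pi0) k l :
    itinerary w0 pi0 k = itinerary w0 pi0 l -> (k < l)%N ->
    if neg (letter (itinerary w0 pi0 k) 0) then ((pi0^-1)%g l < (pi0^-1)%g k)%N
    else ((pi0^-1)%g k < (pi0^-1)%g l)%N.
  move=> ikl kl; have := itinerary_fibre_mono wpi0 1 ikl kl.
  by rewrite big_ord1 oddb expg1.
pose t := (pi'^-1 * pi)%g.
have tK k : (pi^-1)%g (t k) = (pi'^-1)%g k by rewrite permM permK.
have it k : itinerary w pi (t k) = itinerary w pi k.
  apply: (@perm_inj _ (cshift q itin_period)).
  by rewrite -!itinerary_perm tK iE itinerary_perm -iE itinerary_perm.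
have t1 : t = 1%g.
  apply/permP => k0; rewrite perm1.
  pose C := [set k | itinerary w pi k == itinerary w pi k0].
  have := @increasing_perm_id _ t C; apply; last by rewrite inE.
    by move=> k; rewrite !inE it.
  move=> k l; rewrite !inE => /eqP kC /eqP lC kl.
  have ikl : itinerary w pi k = itinerary w pi l by rewrite kC lC.
  have := mono _ _ wpi' k l; rewrite -!iE => /(_ ikl kl).
  case: (ltngtP (t k) (t l)) => // tkl; last first.
    by move/val_inj/perm_inj: tkl kl => ->; rewrite ltnn.
  have := mono _ _ wpi (t l) (t k); rewrite !it !tK => /(_ (esym ikl) tkl).
  by rewrite ikl; case: ifP => _ h1 h2; have := ltn_trans h1 h2; rewrite ltnn.
have pE : pi = pi'.
  by apply: (mulgI pi'^-1%g); rewrite mulVg; exact: t1.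
split=> //; apply/ffunP => k.
have := congr1 (fun x => letter x 0) (iE (pi k)).
by rewrite !letter_itinerary -pE !expg1 permK.
Qed.

End Itinerary.

(** * Cycle lengths *)

Section PorbitBig.
Variables (R : Type) (idx : R) (op : Monoid.com_law idx).
Variables (T : finType) (s : {perm T}).

Lemma big_porbits (F : T -> R) :
  \big[op/idx]_x F x = \big[op/idx]_(c in porbits s) \big[op/idx]_(x in c) F x.
Proof.
rewrite (partition_big (porbit s) (mem (porbits s))) /= => [|x _]; last first.
  exact: imset_f.
by apply: eq_bigr => c /imsetP[y _ ->]; apply: eq_bigl => x; rewrite eq_porbit_mem.
Qed.

Lemma big_porbit (F : T -> R) x :
  \big[op/idx]_(y in porbit s x) F y
  = \big[op/idx]_(t < #|porbit s x|) F ((s ^+ t)%g x).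
Proof.
rewrite (eq_bigl (mem (traject s x #|porbit s x|))) => [|y]; last first.
  exact: porbit_traject.
rewrite -big_uniq ?uniq_traject_porbit //=.
have -> m : traject s x m = [seq (s ^+ t)%g x | t <- index_iota 0 m].
  apply: (@eq_from_nth _ x) => [|i]; rewrite size_traject.
    by rewrite size_map size_iota subn0.
  by move=> im; rewrite nth_traject // (nth_map 0%N) ?size_iota ?subn0 //
    nth_iota ?subn0 // permX.
by rewrite big_map big_mkord.
Qed.

End PorbitBig.

Lemma num_cycles_porbits n i (pi : 'S_n) :
  (num_cycles i pi * i)%N = #|[set k | #|porbit pi k| == i]|.
Proof.
rewrite -sum1_card (eq_bigl (fun k => #|porbit pi k| == i)) => [|k]; last first.
  by rewrite inE.
rewrite big_mkcond (big_porbits _ pi) /= /num_cycles -sum_nat_const.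
rewrite [RHS](bigID (fun c : {set 'I_n} => #|c| == i)) /= [X in (_ + X)%N]big1.
  rewrite addn0; apply: eq_big => [c|c]; rewrite inE // => /andP[/imsetP[x _ ->]].
  move=> /eqP ci; rewrite -{1}ci -sum1_card; apply: eq_bigr => y.
  by rewrite -eq_porbit_mem => /eqP ->; rewrite ci eqxx.
move=> c /andP[/imsetP[x _ ->] xi]; apply: big1 => y.
by rewrite -eq_porbit_mem => /eqP ->; rewrite (negbTE xi).
Qed.

(** The first letters of the words in an orbit are the letters of one period, so this is the parity
    of the number of negative letters of the necklace. *)
Definition orbit_neg q (neg : pred 'I_q) L (c : {set cword q L}) : bool :=
  odd (\sum_(x in c) neg (letter x 0))%N.

Section CycleStructure.
Variables (q : nat) (neg : pred 'I_q) (n : nat).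
Let L := itin_period n.
Let S := cshift q L.

(* Cycles of length i lying over an orbit of length p, when each word of the
   orbit is the itinerary of m points. *)
Definition cycles_over (b : bool) (p m i : nat) : nat :=
  (if b then (p == i) * odd m + (p.*2 == i) * m./2 else (p == i) * m)%N.

Variables (w : {ffun 'I_n -> 'I_q}) (pi : 'S_n).
Hypothesis wpi : standardizes neg w pi.
Let s := (pi^-1)%g.
Let ow := itinerary w pi.
Let m x := #|[set k | ow k == x]|.

Lemma card_fibre_cshift x : m (S x) = m x.
Proof.
rewrite /m -[RHS](card_imset _ (@perm_inj _ s)); apply: eq_card => k.
rewrite !inE; apply/idP/imsetP => [kx|[l]].
  exists (s^-1 k)%g; last by rewrite permKV.
  by rewrite inE -(inj_eq (@perm_inj _ S)) -itinerary_perm permKV.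
by rewrite inE => /eqP lx ->; rewrite /ow itinerary_perm -/ow lx.
Qed.

Lemma card_fibre_porbit x y : y \in porbit S x -> m y = m x.
Proof.
case/porbitP => t ->; elim: t => [|t IHt]; first by rewrite expg0 perm1.
by rewrite expgSr permM card_fibre_cshift.
Qed.

Lemma card_over_porbit x :
  #|[set k | ow k \in porbit S x]| = (#|porbit S x| * m x)%N.
Proof.
rewrite -sum_nat_const -sum1_card.
rewrite (eq_bigl (fun k => ow k \in porbit S x)) => [|k]; last by rewrite inE.
rewrite (partition_big ow (mem (porbit S x))) //=; apply: eq_bigr => y yx.
rewrite -(card_fibre_porbit yx) /m -sum1_card; apply: eq_bigl => k.
by rewrite inE; case: eqP => [->|]; rewrite ?andbF // yx.
Qed.

Lemma orbit_neg_sum x :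
  orbit_neg neg (porbit S x) = odd (\sum_(t < #|porbit S x|) neg (letter x t)).
Proof.
rewrite /orbit_neg big_porbit; congr odd; apply: eq_bigr => t _.
by rewrite letter_cshift.
Qed.

(** Both sides count the points on i-cycles over the orbit of x: each of its p words carries equally
    many. The length of these cycles is read off from s^p, which maps the fibre of x to itself
    monotonically. *)
Lemma card_fibre_cycle_length x i :
  (#|porbit S x| * #|[set k in [set k | ow k == x] | #|porbit s k| == i]|
   = i * cycles_over (orbit_neg neg (porbit S x)) #|porbit S x| (m x) i)%N.
Proof.
set p := #|porbit S x|; set C := [set k | ow k == x].
have p0 : (0 < p)%N by rewrite card_gt0; apply/set0Pn; exists x; apply: porbit_id.
have owC k t : (p %| t)%N -> k \in C -> (s ^+ t)%g k \in C.
  rewrite -porbit_dvd !inE => /eqP tx /eqP kx.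
  by rewrite /ow itinerary_expg -/ow kx -/L -/S tx.
have pdvd k : k \in C -> (p %| #|porbit s k|)%N.
  rewrite inE -porbit_dvd => /eqP <-; rewrite /ow -itinerary_expg.
  by rewrite permX iter_porbit.
have spC : {in C, forall k, (s ^+ p)%g k \in C} by move=> k; apply: owC.
have mono k l : k \in C -> l \in C -> (k < l)%N ->
    if orbit_neg neg (porbit S x) then ((s ^+ p)%g l < (s ^+ p)%g k)%N
    else ((s ^+ p)%g k < (s ^+ p)%g l)%N.
  rewrite !inE => /eqP kC /eqP lC kl.
  have := itinerary_fibre_mono wpi p _ kl; rewrite -/ow kC lC => /(_ erefl).
  by rewrite orbit_neg_sum.
have mC : m x = #|C| by [].
clearbody C; rewrite mC /cycles_over; case: ifP mono => _ mono.
  have sK := decreasing_permK spC mono.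
  (* The length is a multiple p * e of p, and it divides 2 p because s^p is an involution of the
     fibre; so e is 1 or 2. *)
  have len k : k \in C ->
      #|porbit s k| = if (s ^+ p)%g k == k then p else p.*2.
    move=> kC; have /dvdnP[e eE] := pdvd k kC.
    have : (#|porbit s k| %| p.*2)%N.
      by rewrite -porbit_dvd -addnn expgD permM sK.
    rewrite porbit_dvd eE -muln2 mulnC dvdn_pmul2l // => e2.
    have -> : (p * e %| p)%N = (e == 1)%N.
      by rewrite -{2}[p]muln1 dvdn_pmul2l // dvdn1.
    by move: e2; rewrite dvdn_divisors // !inE => /orP[]/eqP->; rewrite ?muln1.
  have fixE := card_fix_decreasing_perm spC mono.
  have CE : (odd #|C| + #|C|./2.*2 = #|C|)%N by rewrite odd_double_half.
  have nfixE : #|[set k in C | (s ^+ p)%g k != k]| = #|C|./2.*2.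
    apply/eqP; rewrite -(eqn_add2l (odd #|C|)) CE -[nat_of_bool _]fixE; apply/eqP.
    rewrite -!sum1_card [in RHS](bigID (fun k => (s ^+ p)%g k == k)) /=.
    by congr (_ + _)%N; apply: eq_bigl => k; rewrite inE.
  have -> : [set k in C | #|porbit s k| == i]
      = (if p == i then [set k in C | (s ^+ p)%g k == k] else finset.set0)
        :|: (if p.*2 == i then [set k in C | (s ^+ p)%g k != k] else finset.set0).
    apply/setP => k; rewrite !inE.
    case kC: (k \in C); last first.
      by do 2!case: ifP => _; rewrite !inE /= ?kC.
    rewrite len //=; case: (eqVneq ((s ^+ p)%g k) k) => sk.
      by do 2!case: ifP => _; rewrite !inE /= ?kC ?sk ?eqxx.
    by do 2!case: ifP => _; rewrite !inE /= ?kC ?sk ?(negbTE sk).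
  rewrite cardsU; set I := _ :&: _.
  have -> : I = finset.set0.
    apply/setP => k; rewrite !inE.
    by do 2!case: ifP => _; rewrite !inE ?andbF //; case: eqP; rewrite ?andbF.
  rewrite cards0 subn0 !mulnDr; congr (_ + _)%N.
    by case: eqP => [<-|_]; rewrite ?cards0 ?mul1n ?mul0n ?muln0 // fixE.
  case: eqP => [<-|_]; rewrite ?cards0 ?mul1n ?mul0n ?muln0 // nfixE.
  by rewrite -!muln2 ?mul1n mulnA mulnAC.
have len k : k \in C -> #|porbit s k| = p.
  move=> kC; apply/eqP; rewrite eqn_dvd pdvd // -porbit_dvd andbT; apply/eqP.
  by apply: (@increasing_perm_id _ (s ^+ p)%g C).
case: (eqVneq p i) => [<-|pi0].
  rewrite mul1n; congr (_ * _)%N; apply: eq_card => k; rewrite !inE.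
  by case kC: (k \in C); rewrite // len // eqxx.
rewrite mul0n muln0; apply/eqP; rewrite muln_eq0; apply/orP; right.
rewrite cards_eq0; apply/eqP/setP => k; rewrite !inE.
by case kC: (k \in C); rewrite // len // (negbTE pi0).
Qed.

(** The quotient by #|c| is the number of points over each single word of c. Multiplied by i, the
    statement counts the points on i-cycles, grouped by itinerary. *)
Lemma num_cycles_std i : (0 < i)%N ->
  num_cycles i pi = \sum_(c in porbits S)
    cycles_over (orbit_neg neg c) #|c| (#|[set k | ow k \in c]| %/ #|c|) i.
Proof.
move=> i0; apply/eqP; rewrite -(eqn_pmul2l i0) mulnC num_cycles_porbits.
rewrite -sum1_card (eq_bigl (fun k => #|porbit s k| == i)) => [|k]; last first.
  by rewrite inE porbitV.
rewrite (partition_big ow predT) //= (big_porbits _ S) big_distrr /=; apply/eqP.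
apply: eq_bigr => c /imsetP[x _ ->].
have p0 : (0 < #|porbit S x|)%N.
  by rewrite card_gt0; apply/set0Pn; exists x; apply: porbit_id.
have E y : y \in porbit S x ->
    ((\sum_(k | (#|porbit s k| == i) && (ow k == y)) 1) * #|porbit S x|
     = i * cycles_over (orbit_neg neg (porbit S x)) #|porbit S x| (m x) i)%N.
  move=> yx; rewrite -(card_fibre_porbit yx).
  have <- : porbit S y = porbit S x by apply/eqP; rewrite eq_porbit_mem.
  rewrite -card_fibre_cycle_length [RHS]mulnC; congr (_ * _)%N; rewrite -sum1_card.
  by apply: eq_bigl => k; rewrite !inE andbC.
apply/eqP; rewrite -(eqn_pmul2r p0) big_distrl /= (eq_bigr _ E).
by rewrite sum_nat_const card_over_porbit mulKn // mulnC.
Qed.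

End CycleStructure.

(** * Formal power series and logarithmic derivatives *)

Section FpsTheory.
Variable A : comNzRingType.
Implicit Types (F G h : fps A) (b c : A).

Lemma coefs_sum (I : Type) (r : seq I) (P : pred I) (F : I -> fps A) n :
  coefs (\sum_(i <- r | P i) F i) n = \sum_(i <- r | P i) coefs (F i) n.
Proof. exact: (big_morph (fun G => coefs G n)). Qed.

Lemma coefs_mul F G n :
  coefs (F * G) n = \sum_(i < n.+1) coefs F i * coefs G (n - i)%N.
Proof. by []. Qed.

Lemma coefsD F G n : coefs (F + G) n = coefs F n + coefs G n.
Proof. by []. Qed.

Lemma coefsB F G n : coefs (F - G) n = coefs F n - coefs G n.
Proof. by []. Qed.

Lemma coefs1 n : coefs (1 : fps A) n = (n == 0)%N%:R.
Proof. by []. Qed.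

(** The Euler operator u d/du, a derivation that preserves degrees. *)
Definition fps_theta F := Fps (fun n => coefs F n *+ n).

Lemma fps_thetaM F G : fps_theta (F * G) = fps_theta F * G + F * fps_theta G.
Proof.
apply/fpsP => n; rewrite coefsD !coefs_mul /= -sumrMnl -big_split /=.
apply: eq_bigr => i _.
by rewrite mulrnAl mulrnAr -mulrnDr subnKC // -ltnS.
Qed.

Lemma fps_theta1 : fps_theta 1 = 0.
Proof. by apply/fpsP => -[|n] //=; rewrite mul0rn. Qed.

Lemma fps_thetaD F G : fps_theta (F + G) = fps_theta F + fps_theta G.
Proof. by apply/fpsP => n /=; rewrite mulrnDl. Qed.

Lemma fps_thetaN F : fps_theta (- F) = - fps_theta F.
Proof. by apply/fpsP => n /=; rewrite mulNrn. Qed.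

Lemma fps_theta_prod (I : Type) (r : seq I) (P : pred I) (F h : I -> fps A) :
  (forall i, P i -> fps_theta (F i) = F i * h i) ->
  fps_theta (\prod_(i <- r | P i) F i)
  = (\prod_(i <- r | P i) F i) * \sum_(i <- r | P i) h i.
Proof.
move=> Fh; apply: (big_ind2 (fun G g => fps_theta G = G * g)) => //.
- by rewrite fps_theta1 mulr0.
- move=> G1 g1 G2 g2 E1 E2; rewrite fps_thetaM E1 E2; ring.
Qed.

(** Here h is the logarithmic derivative of F; as it has no constant term, only coefficients of F of
    degree below n occur on the right. *)
Lemma coefs_theta_rec F h n : fps_theta F = F * h -> coefs h 0 = 0 ->
  coefs F n *+ n = \sum_(l < n) coefs h l.+1 * coefs F (n - l.+1)%N.
Proof.
move=> E h0; have -> : coefs F n *+ n = coefs (h * F) n by rewrite mulrC -E.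
rewrite coefs_mul big_ord_recl h0 mul0r add0r.
by apply: eq_bigr.
Qed.

Definition fps_mono (a : nat) b : fps A := Fps (fun n => b *+ (n == a)).

Lemma coefs_monoM a b F n : coefs (fps_mono a b * F) n
  = if (a <= n)%N then b * coefs F (n - a)%N else 0.
Proof.
rewrite coefs_mul; case: leqP => an; last first.
  rewrite big1 // => i _ /=; rewrite ltn_eqF ?mul0r //.
  by rewrite (leq_ltn_trans _ an) // -ltnS.
rewrite (bigD1 (Ordinal (an : (a < n.+1)%N))) //= eqxx big1 ?addr0 // => i.
by rewrite -val_eqE /= => /negbTE ->; rewrite mul0r.
Qed.

Lemma fps_monoM a b a' b' :
  fps_mono a b * fps_mono a' b' = fps_mono (a + a') (b * b').
Proof.
apply/fpsP => n; rewrite coefs_monoM /=; case: leqP => an.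
  by rewrite mulrnAr -(eqn_add2l a) subnKC.
by rewrite ltn_eqF // (leq_trans an) // leq_addr.
Qed.

Lemma fps_mono1 : fps_mono 0 1 = 1.
Proof. by []. Qed.

Lemma fps_mono_prod (I : Type) (r : seq I) (P : pred I) (a : I -> nat) (b : I -> A) :
  \prod_(i <- r | P i) fps_mono (a i) (b i)
  = fps_mono (\sum_(i <- r | P i) a i) (\prod_(i <- r | P i) b i).
Proof.
elim/big_rec3: _ => [|i n x F _ ->]; first by rewrite fps_mono1.
exact: fps_monoM.
Qed.

Lemma fps_monoX a b k : fps_mono a b ^+ k = fps_mono (a * k) (b ^+ k).
Proof.
elim: k => [|k IHk]; first by rewrite muln0 fps_mono1.
by rewrite !exprS IHk fps_monoM mulnS.
Qed.

Lemma fps_theta_mono a b : fps_theta (fps_mono a b) = fps_mono a (b *+ a).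
Proof.
by apply/fpsP => n /=; case: eqP => [->|_]; rewrite ?mulr1n // !mulr0n mul0rn.
Qed.

(** The series 1 / (1 - c u^p). *)
Definition fps_geom (p : nat) c : fps A :=
  Fps (fun n => if (p %| n)%N then c ^+ (n %/ p) else 0).

(** The logarithmic derivative p c u^p / (1 - c u^p) of the previous series. *)
Definition fps_geom_log (p : nat) c : fps A :=
  Fps (fun n => if (p %| n)%N && (0 < n)%N then c ^+ (n %/ p) *+ p else 0).

Section Geom.
Variable p : nat.
Hypothesis p0 : (0 < p)%N.

Lemma coefs_mono_geom b c n : coefs (fps_mono p b * fps_geom p c) n
  = if (p %| n)%N && (0 < n)%N then b * c ^+ (n %/ p).-1 else 0.
Proof.
rewrite coefs_monoM /=; case: (posnP n) => [->|n0].
  by rewrite andbF leqNgt p0.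
rewrite andbT; case: leqP => pn; last first.
  by case: ifP => // /(dvdn_leq n0); rewrite leqNgt pn.
rewrite dvdn_subl //; case: ifP => [/dvdnP[m ->]|]; last by rewrite mulr0.
by rewrite -{2}[p]mul1n -mulnBl !mulnK // subn1.
Qed.

Lemma fps_geomK c : (1 - fps_mono p c) * fps_geom p c = 1.
Proof.
apply/fpsP => n; rewrite mulrBl mul1r coefsB coefs_mono_geom coefs1 /=.
case: (posnP n) => [->|n0]; first by rewrite dvdn0 div0n expr0 subr0.
rewrite andbT mulr0n; case: ifP => pn; last by rewrite subr0.
by rewrite -exprS prednK ?subrr // divn_gt0 // dvdn_leq.
Qed.

Lemma fps_geom_logE c : fps_theta (fps_mono p c) * fps_geom p c = fps_geom_log p c.
Proof.
rewrite fps_theta_mono; apply/fpsP => n; rewrite coefs_mono_geom /=.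
case: ifP => // /andP[pn n0].
by rewrite mulrnAl -exprS prednK // divn_gt0 // dvdn_leq.
Qed.

Lemma fps_theta_geom c : fps_theta (fps_geom p c) = fps_geom p c * fps_geom_log p c.
Proof.
have := congr1 fps_theta (fps_geomK c).
rewrite fps_theta1 fps_thetaM fps_thetaD fps_thetaN fps_theta1 => E.
have {}E : (1 - fps_mono p c) * fps_theta (fps_geom p c)
    = fps_theta (fps_mono p c) * fps_geom p c.
  by rewrite -[RHS]addr0 -E; ring.
rewrite -fps_geom_logE -E mulrA [_ * (1 - _)]mulrC fps_geomK; ring.
Qed.

(** 1 + b u^p is the inverse of the geometric series of ratio - b u^p, so its logarithmic derivative
    is the opposite one. *)
Lemma fps_theta_add_mono b : fps_theta (1 + fps_mono p b)
  = (1 + fps_mono p b) * - fps_geom_log p (- b).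
Proof.
have monoN : fps_mono p (- b) = - fps_mono p b.
  by apply/fpsP => n /=; rewrite mulNrn.
have := fps_geomK (- b); rewrite monoN opprK => E.
rewrite -fps_geom_logE monoN fps_thetaN mulNr opprK mulrCA E.
by rewrite fps_thetaD fps_theta1; ring.
Qed.

End Geom.

Lemma coefs0_prod (I : Type) (r : seq I) (P : pred I) (F : I -> fps A) :
  coefs (\prod_(i <- r | P i) F i) 0 = \prod_(i <- r | P i) coefs (F i) 0.
Proof.
apply: (big_morph (fun G => coefs G 0)) => // F1 F2.
by rewrite coefs_mul big_ord1.
Qed.

Lemma eq_coefs_prod (I : Type) (r : seq I) (P : pred I) (F G : I -> fps A) n :
  (forall i k, (k <= n)%N -> coefs (F i) k = coefs (G i) k) ->
  forall k, (k <= n)%N ->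
  coefs (\prod_(i <- r | P i) F i) k = coefs (\prod_(i <- r | P i) G i) k.
Proof.
move=> FG; apply: (big_ind2 (fun F1 G1 : fps A =>
    forall k, (k <= n)%N -> coefs F1 k = coefs G1 k)) => // [|i _]; last exact: FG.
move=> F1 G1 F2 G2 E1 E2 k kn; rewrite !coefs_mul; apply: eq_bigr => i _.
by rewrite E1 ?E2 // (leq_trans _ kn) ?leq_subr // -ltnS.
Qed.

(** Degrees above n do not matter: each factor may be replaced by its finite sum of monomials of
    degree at most n, and the product then expands over the choices N of a degree in each factor. *)
Lemma coefs_prod (I : finType) (P : {set I}) (F : I -> fps A) n :
  coefs (\prod_(i in P) F i) n
  = \sum_(N in pffun_on (ord0 : 'I_n.+1) P predT | (\sum_(i in P) N i == n)%N)
      \prod_(i in P) coefs (F i) (N i).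
Proof.
pose G i := \sum_(j : 'I_n.+1) fps_mono j (coefs (F i) j).
rewrite (@eq_coefs_prod _ _ _ _ G n) // => [|i k kn]; last first.
  rewrite coefs_sum (bigD1 (Ordinal (kn : (k < n.+1)%N))) //= eqxx.
  rewrite big1 ?addr0 // => j; rewrite -val_eqE /= eq_sym => /negbTE ->.
  by rewrite mulr0n.
rewrite (big_distr_big ord0) /= coefs_sum big_mkcondr /=; apply: eq_bigr => N _.
by rewrite fps_mono_prod /= eq_sym; case: eqP.
Qed.

End FpsTheory.

Section FpsExp.
Variables (R : numFieldType) (A : comAlgType R).

Lemma mulrn_inj (x y : A) n : (0 < n)%N -> x *+ n = y *+ n -> x = y.
Proof.
have E (z : A) : z *+ n = (n%:R : R) *: z by rewrite scaler_nat.
move=> n0; rewrite !E => /(congr1 ( *:%R n%:R^-1)).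
by rewrite !scalerA mulVf ?scale1r // pnatr_eq0 -lt0n.
Qed.

(** The recursion is assumed up to degree n only, since the finite products to which this applies
    satisfy it no further. *)
Lemma coefs_rec_unique (f g h : nat -> A) n :
  f 0%N = g 0%N ->
  (forall k, (k <= n)%N -> f k *+ k = \sum_(l < k) h l.+1 * f (k - l.+1)%N) ->
  (forall k, (k <= n)%N -> g k *+ k = \sum_(l < k) h l.+1 * g (k - l.+1)%N) ->
  forall k, (k <= n)%N -> f k = g k.
Proof.
move=> fg0 fE gE; elim/ltn_ind => -[|k] IHk kn //.
apply: (@mulrn_inj _ _ k.+1) => //; rewrite fE // gE //.
apply: eq_bigr => l _; congr (_ * _); have lt : (k.+1 - l.+1 < k.+1)%N.
  by rewrite subSS ltnS leq_subr.
by apply: IHk => //; apply: ltnW (leq_trans lt kn).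
Qed.

Lemma coefs_exp_mono a (b : A) n : (0 < a)%N ->
  coefs (fps_exp (fps_mono a b)) n
  = if (a %| n)%N then ((n %/ a)`!%:R^-1 : R) *: b ^+ (n %/ a) else 0.
Proof.
move=> a0 /=; under eq_bigr => k _ do rewrite fps_monoX /=.
case: ifP => an.
  have lt : (n %/ a < n.+1)%N by rewrite ltnS leq_div.
  rewrite (bigD1 (Ordinal lt)) //= mulnC divnK // eqxx big1 ?addr0 // => k.
  rewrite -val_eqE /= => /negP nk; case: eqP => [E|]; last by rewrite scaler0.
  by case: nk; rewrite eqn_div // mulnC; apply/eqP.
rewrite big1 // => k _; case: eqP => [E|]; last by rewrite mulr0n scaler0.
by case/negP: (negbT an); rewrite E dvdn_mulr.
Qed.

Lemma fps_theta_exp_mono a (b : A) : (0 < a)%N ->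
  fps_theta (fps_exp (fps_mono a b))
  = fps_exp (fps_mono a b) * fps_mono a (b *+ a).
Proof.
move=> a0; apply/fpsP => n; rewrite mulrC coefs_monoM.
have -> : coefs (fps_theta (fps_exp (fps_mono a b))) n
  = coefs (fps_exp (fps_mono a b)) n *+ n by [].
rewrite !coefs_exp_mono //; case: (posnP n) => [->|n0].
  by rewrite mulr0n leqNgt a0.
case: leqP => an; last first.
  by case: ifP => [/(dvdn_leq n0)|]; rewrite ?mul0rn // leqNgt an.
rewrite dvdn_subl //; case: ifP => [/dvdnP[[|m] nE]|_]; last first.
- by rewrite mul0rn mulr0.
- have E (z : A) : z *+ m.+1 = (m.+1%:R : R) *: z by rewrite scaler_nat.
  rewrite nE mulSn addKn -mulSn !mulnK // mulrnA E scalerA factS natrM invfM.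
  by rewrite mulrA mulfV ?mul1r ?pnatr_eq0 // mulrnAl -scalerAr -exprS.
- by rewrite nE in n0.
Qed.

End FpsExp.

Section FpsExpMonomial.
Variables (R : numFieldType) (A : comAlgType R).

Lemma scale_fpsX_fpsC (c : R) (a : A) i j :
  c *: (fpsX A ^+ i * fpsC a) ^+ j = fps_mono (i * j) (c *: a ^+ j).
Proof.
have -> : fpsX A = fps_mono 1 1 by [].
have -> : fpsC a = fps_mono 0 a by [].
rewrite fps_monoX fps_monoM fps_monoX expr1n mul1r mul1n addn0.
by apply/fpsP => n /=; rewrite scalerMnr.
Qed.

(** The operator u d/du brings down the degree i j, which cancels the denominator i j in the
    exponent. *)
Lemma fps_theta_exp_fpsX_fpsC (c : R) (a : A) i j : (0 < i)%N -> (0 < j)%N ->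
  let F := fps_exp (((i * j)%:R^-1 * c) *: (fpsX A ^+ i * fpsC a) ^+ j) in
  fps_theta F = F * fps_mono (i * j) (c *: a ^+ j).
Proof.
move=> i0 j0 /=; have ij0 : (0 < i * j)%N by rewrite muln_gt0 i0.
rewrite scale_fpsX_fpsC fps_theta_exp_mono //; congr (_ * fps_mono _ _).
by rewrite scalerMnl -[_ *+ (i * j)]mulr_natl mulrA mulfV ?mul1r // pnatr_eq0 -lt0n.
Qed.

Lemma coefs0_exp (F : fps A) : coefs (fps_exp F) 0 = 1.
Proof. by rewrite /= big_ord1 fact0 invr1 scale1r expr0. Qed.

End FpsExpMonomial.

(** * The multiset of necklaces of a word *)

Lemma sum_porbits (V : nmodType) (T : finType) (s : {perm T}) (F : {set T} -> V) :
  \sum_(c in porbits s) F c *+ #|c| = \sum_x F (porbit s x).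
Proof.
rewrite [RHS](big_porbits _ s); apply: eq_bigr => c /imsetP[x _ ->].
rewrite -sumr_const; apply: eq_bigr => y; rewrite -eq_porbit_mem => /eqP <-.
by [].
Qed.

Lemma card_porbits_gt0 (T : finType) (s : {perm T}) c :
  c \in porbits s -> (0 < #|c|)%N.
Proof.
by case/imsetP=> x _ ->; rewrite card_gt0; apply/set0Pn; exists x; apply: porbit_id.
Qed.

Section OrbitSeries.
Variables (A : comNzRingType) (q : nat) (neg : pred 'I_q) (L : nat).
Variables (y : 'I_q -> A) (X : nat -> A).
Implicit Type c : {set cword q L}.

Definition orbit_wt c : A := \prod_(x in c) y (letter x 0).

Definition orbit_fps c : fps A :=
  if orbit_neg neg c
  then (1 + fps_mono #|c| (orbit_wt c * X #|c|))
       * fps_geom #|c|.*2 (orbit_wt c ^+ 2 * X #|c|.*2)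
  else fps_geom #|c| (orbit_wt c * X #|c|).

Definition orbit_log c : fps A :=
  if orbit_neg neg c
  then fps_geom_log #|c|.*2 (orbit_wt c ^+ 2 * X #|c|.*2)
       - fps_geom_log #|c| (- (orbit_wt c * X #|c|))
  else fps_geom_log #|c| (orbit_wt c * X #|c|).

Lemma fps_theta_orbit c : (0 < #|c|)%N ->
  fps_theta (orbit_fps c) = orbit_fps c * orbit_log c.
Proof.
move=> c0; rewrite /orbit_fps /orbit_log; case: ifP => _.
  rewrite fps_thetaM fps_theta_add_mono // fps_theta_geom ?double_gt0 //; ring.
exact: fps_theta_geom.
Qed.

(** In degree m #|c| this is the contribution of m copies of the necklace. With an odd number of
    negative letters, the factor 1 + y X_p u^p accounts for the parity of m and the geometric series
    for the m./2 pairs of copies. *)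
Lemma coefs_orbit_fps c r : (0 < #|c|)%N -> coefs (orbit_fps c) r =
  if (#|c| %| r)%N then
    let m := (r %/ #|c|)%N in orbit_wt c ^+ m *
      (if orbit_neg neg c then X #|c| ^+ odd m * X #|c|.*2 ^+ m./2 else X #|c| ^+ m)
  else 0.
Proof.
set p := #|c|; set Y := orbit_wt c => p0; rewrite /orbit_fps -/p -/Y.
case: ifP => _; last by rewrite /=; case: ifP => _ //; rewrite exprMn.
have p20 : (0 < p.*2)%N by rewrite double_gt0.
rewrite mulrDl mul1r coefsD coefs_monoM.
case: (boolP (p %| r)%N) => [/dvdnP[m ->]|/negbTE npr]; last first.
  have np2 s : (p %| s)%N = false -> (p.*2 %| s)%N = false.
    move=> nps; apply/negP; rewrite -muln2 => /(dvdn_trans (dvdn_mulr _ (dvdnn _))).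
    by rewrite nps.
  rewrite /= np2 // add0r; case: leqP => // pr.
  by rewrite np2 ?mulr0 // dvdn_subl.
rewrite mulnK //; have := odd_double_half m; set e := m./2.
have odd_dvd k : (p * 2 %| (1 + k.*2) * p)%N = false.
  by rewrite [(p * 2)%N]mulnC dvdn_pmul2r // dvdn2 oddD odd_double.
have Y2 k : Y ^+ k.*2 = (Y ^+ 2) ^+ k by rewrite -exprM mul2n.
have dblE k : (k.*2 * p = k * (p * 2))%N by rewrite -muln2 -mulnA [(2 * p)%N]mulnC.
rewrite /= -(muln2 p); case: (odd m) => /= <-.
  rewrite odd_dvd leq_pmull // mulnDl mul1n addKn dblE.
  rewrite dvdn_mull // mulnK ?muln_gt0 ?p0 // add0r.
  by rewrite exprD Y2 exprMn; ring.
rewrite add0n dblE dvdn_mull // mulnK ?muln_gt0 ?p0 // [X in _ + X](_ : _ = 0).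
  by rewrite addr0 Y2 exprMn; ring.
case: e => [|e]; first by rewrite mul0n leqNgt p0.
have -> : (e.+1 * (p * 2) - p = (1 + e.*2) * p)%N.
  by rewrite -dblE doubleS mulSn addKn add1n.
by rewrite odd_dvd mulr0; case: ifP.
Qed.

End OrbitSeries.

(** * Words against multisets of necklaces *)

Section Bijection.
Variables (q : nat) (neg : pred 'I_q) (n : nat).
Let L := itin_period n.
Let S := cshift q L.
Let P := porbits S.

Definition std_pairs : {set {ffun 'I_n -> 'I_q} * 'S_n} :=
  [set wp | standardizes neg wp.1 wp.2].

(** Points are counted, not copies of the necklace: the value at c is #|c| times the multiplicity,
    and the values add up to n. The default outside [P] matches the support condition of
    [pffun_on]. *)
Definition orbit_counts (wp : {ffun 'I_n -> 'I_q} * 'S_n) :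
    {ffun {set cword q L} -> 'I_n.+1} :=
  [ffun c : {set cword q L} =>
     if c \in P then inord #|[set k | itinerary wp.1 wp.2 k \in c]| else ord0].

Lemma val_orbit_counts wp c : c \in P ->
  orbit_counts wp c = #|[set k | itinerary wp.1 wp.2 k \in c]| :> nat.
Proof.
move=> cP; rewrite ffunE cP inordK // ltnS -[X in (_ <= X)%N]card_ord.
exact: max_card.
Qed.

Definition orbit_count_set : {set {ffun {set cword q L} -> 'I_n.+1}} :=
  [set N in pffun_on (ord0 : 'I_n.+1) P predT |
     (\sum_(c in P) N c == n)%N && [forall c in P, #|c| %| N c]%N].

Lemma card_std_pairs_ge : (q ^ n <= #|std_pairs|)%N.
Proof.
have -> : (q ^ n)%N = #|[set wp.1 | wp in std_pairs]|.
  rewrite -[in LHS](card_ord q) -[n in LHS]card_ord -card_ffun -cardsT.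
  congr #|pred_of_set _|; apply/setP => w; rewrite !inE; apply/esym/imsetP.
  have [pi wpi] := standardizes_exists neg w.
  by exists (w, pi); rewrite ?inE.
exact: leq_imset_card.
Qed.

Lemma orbit_counts_inj : {in std_pairs &, injective orbit_counts}.
Proof.
move=> [w pi] [w' pi']; rewrite !inE /= => wpi wpi' /ffunP E.
have [] // := standardizes_itinerary_inj wpi wpi'; last by move=> -> ->.
move=> x; have xP : porbit S x \in P by apply: imset_f.
have p0 := card_porbits_gt0 xP.
have := congr1 (@nat_of_ord _) (E (porbit S x)).
rewrite !val_orbit_counts //= !card_over_porbit => /eqP.
by rewrite eqn_pmul2l // => /eqP.
Qed.

Lemma orbit_counts_sub : {in std_pairs, forall wp, orbit_counts wp \in orbit_count_set}.
Proof.
move=> [w pi]; rewrite !inE => /= wpi; apply/and3P; split.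
- apply/pffun_onP; split; last by [].
  by apply/supportP => c; rewrite ffunE => /negbTE ->.
- apply/eqP; under eq_bigr => c cP do rewrite val_orbit_counts //= -sum1_card.
  rewrite -[RHS]card_ord -sum1_card (partition_big (itinerary w pi) predT) //=.
  rewrite (big_porbits _ S) /=; apply: eq_bigr => c _.
  rewrite (partition_big (itinerary w pi) (mem c)) => [|k] /=; last by rewrite inE.
  apply: eq_bigr => x xc; apply: eq_bigl => k; rewrite inE.
  by case: eqP => [->|]; rewrite ?andbF ?xc.
- apply/forall_inP => c cP; rewrite val_orbit_counts //.
  by case/imsetP: cP => x _ ->; rewrite card_over_porbit dvdn_mulr.
Qed.

(** The cardinal is the coefficient of u^n in the product of the series 1 / (1 - u^#|c|). This
    product agrees with 1 / (1 - q u) up to degree n: for 0 < l <= n, the coefficient of u^l in its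
    logarithmic derivative is the number q^l of words fixed by the l-th shift, because l divides
    n!. *)
Lemma card_orbit_count_set : #|orbit_count_set| = (q ^ n)%N.
Proof.
pose f (c : {set cword q L}) : fps rat := fps_geom #|c| 1.
have fE : coefs (\prod_(c in P) f c) n = #|orbit_count_set|%:R.
  rewrite coefs_prod -sum1_card natr_sum.
  rewrite (bigID (fun N : {ffun _ -> 'I_n.+1} => [forall c in P, #|c| %| N c]%N)) /=.
  rewrite [X in _ + X]big1 ?addr0 => [|N]; last first.
    move=> /andP[_]; rewrite negb_forall_in => /exists_inP[c cP cN].
    by rewrite (bigD1 c) //= (negbTE cN) mul0r.
  apply: eq_big => [N|N /andP[_ /forall_inP cN]]; first by rewrite [RHS]inE andbA.
  by apply: big1 => c cP; rewrite cN // expr1n.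
have thf : fps_theta (\prod_(c in P) f c)
    = (\prod_(c in P) f c) * \sum_(c in P) fps_geom_log #|c| 1.
  apply: fps_theta_prod => c cP; apply: fps_theta_geom.
  exact: card_porbits_gt0 cP.
have logE l : (0 < l)%N -> (l <= n)%N ->
    coefs (\sum_(c in P) fps_geom_log #|c| (1 : rat)) l = q%:R ^+ l.
  move=> l0 ln; rewrite coefs_sum /=.
  transitivity (\sum_(c in P) (if (#|c| %| l)%N then 1 else 0 : rat) *+ #|c|).
    by apply: eq_bigr => c _; rewrite l0 andbT expr1n; case: ifP; rewrite ?mul0rn.
  rewrite sum_porbits -big_mkcond /= -[q in RHS]card_ord -sumr_const.
  rewrite -(@sum_cshift_fix q L _ (fun=> 1)) //; last first.
    by rewrite itin_periodE dvdn_fact // l0.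
  by apply: eq_big => [x|x _]; rewrite ?porbit_dvd // big1.
pose g := fps_geom 1 (q%:R : rat).
have gE := fps_theta_geom (isT : (0 < 1)%N) (q%:R : rat).
have f0 : coefs (\prod_(c in P) f c) 0 = coefs g 0.
  by rewrite coefs0_prod /= big1 // => c _; rewrite dvdn0 div0n expr0.
have : coefs (\prod_(c in P) f c) n = coefs g n.
  apply: (@coefs_rec_unique rat rat^o (coefs (\prod_(c in P) f c)) (coefs g)
    (fun l => q%:R ^+ l) n f0 _ _ n (leqnn n)) => k kn.
    rewrite (coefs_theta_rec _ thf); last first.
      by rewrite coefs_sum big1 // => c _ /=; rewrite andbF.
    by apply: eq_bigr => l _; rewrite logE // (leq_trans _ kn).
  rewrite (coefs_theta_rec _ gE) //; apply: eq_bigr => l _.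
  by rewrite /= dvd1n divn1 mulr1n.
rewrite fE /= dvd1n divn1 -natrX => /eqP; by rewrite eqr_nat => /eqP.
Qed.

Lemma orbit_counts_onto : orbit_counts @: std_pairs = orbit_count_set.
Proof.
apply/eqP; rewrite eqEcard; apply/andP; split.
  by apply/fintype.subsetP => N /imsetP[wp /orbit_counts_sub ? ->].
rewrite card_in_imset; last exact: orbit_counts_inj.
by rewrite card_orbit_count_set card_std_pairs_ge.
Qed.

End Bijection.

(** * Moebius inversion *)

Lemma big_divisors_filter (V : nmodType) (n m : nat) (f : nat -> nat)
    (P : pred nat) (F : nat -> V) : (0 < n)%N -> (0 < m)%N -> injective f ->
  (forall d, ((d %| n) && P d)%N <-> exists2 e, (e %| m)%N & d = f e) ->
  \sum_(d <- divisors n | P d) F d = \sum_(e <- divisors m) F (f e).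
Proof.
move=> n0 m0 finj nm; rewrite -big_filter -(big_map f xpredT F).
apply: perm_big; apply: uniq_perm.
- by rewrite filter_uniq // divisors_uniq.
- by rewrite map_inj_uniq // divisors_uniq.
move=> d; rewrite mem_filter -dvdn_divisors // andbC.
apply/idP/mapP => [/nm [e em ->]|[e]]; first by exists e; rewrite -?dvdn_divisors.
by rewrite -dvdn_divisors // => em ->; apply/nm; exists e.
Qed.

Lemma mobius_dvd_sqr p d : prime p -> (0 < d)%N -> (p * p %| d)%N -> mobius d = 0.
Proof.
move=> pp d0 ppd; rewrite /mobius; case: ifP => // /allP /(_ p).
rewrite mem_primes pp d0 (dvdn_trans (dvdn_mulr p (dvdnn p)) ppd) => /(_ isT) /eqP.
by move: ppd; rewrite mulnn pfactor_dvdn // => + E; rewrite E.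
Qed.

Lemma mobius_mul_prime p d : prime p -> (0 < d)%N -> ~~ (p %| d)%N ->
  mobius (p * d) = - mobius d.
Proof.
move=> pp d0 npd; have p0 := prime_gt0 pp.
have pE : perm_eq (primes (p * d)) (p :: primes d).
  apply: uniq_perm; rewrite ?primes_uniq //=.
    by rewrite mem_primes (negbTE npd) !andbF primes_uniq.
  by move=> r; rewrite primesM // primes_prime // !inE.
rewrite /mobius (perm_all _ pE) (perm_size pE) /=.
rewrite lognM // (logn_prime _ pp) eqxx.
have -> : logn p d = 0%N by rewrite logn_coprime // prime_coprime.
rewrite addn0 eqxx /=.
have -> : all (fun r => logn r (p * d) == 1%N) (primes d)
    = all (fun r => logn r d == 1%N) (primes d).
  apply: eq_in_all => r; rewrite mem_primes => /and3P[rp _ rd].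
  have /negbTE rNp : r != p by apply: contraNneq npd => <-.
  by rewrite lognM // logn_prime // rNp.
by case: ifP; rewrite ?oppr0 // exprS mulN1r.
Qed.

(** For a prime p dividing n, the divisors d prime to p cancel against p d, and those divisible by
    p^2 contribute 0. *)
Lemma sum_mobius n : (0 < n)%N -> \sum_(d <- divisors n) mobius d = (n == 1)%N%:R.
Proof.
move=> n0; case: eqVneq => [->|n1]; first by rewrite big_seq1.
have pp : prime (pdiv n) by rewrite pdiv_prime // ltn_neqAle eq_sym n1.
set p := pdiv n in pp; have pn : (p %| n)%N := pdiv_dvd n; have p0 := prime_gt0 pp.
rewrite (bigID (fun d => p %| d)%N) /= (bigID (fun d => p * p %| d)%N) /=.
rewrite big1_seq ?add0r => [|d /andP[/andP[_ ppd]]]; last first.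
  by rewrite -dvdn_divisors // => /(dvdn_gt0 n0) d0; apply: mobius_dvd_sqr ppd.
rewrite -big_filter -[X in _ + X]big_filter.
have -> : \sum_(d <- [seq d <- divisors n | (p %| d)%N && ~~ (p * p %| d)%N]) mobius d
    = \sum_(d <- [seq d <- divisors n | ~~ (p %| d)%N]) mobius (p * d).
  rewrite -(big_map (muln p) xpredT); apply: perm_big; apply: uniq_perm.
  - by rewrite filter_uniq // divisors_uniq.
  - rewrite map_inj_uniq ?filter_uniq ?divisors_uniq // => a b /eqP.
    by rewrite eqn_pmul2l // => /eqP.
  move=> d; rewrite mem_filter -dvdn_divisors //; apply/idP/mapP => [|[e]].
    case/andP=> /andP[/dvdnP[e ->]]; rewrite mulnC dvdn_pmul2l // => npe pen.
    exists e => //; rewrite mem_filter npe -dvdn_divisors //.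
    exact: dvdn_trans (dvdn_mull _ (dvdnn _)) pen.
  rewrite mem_filter -dvdn_divisors // => /andP[npe en] ->.
  rewrite dvdn_mulr // dvdn_pmul2l // npe /=.
  by rewrite Gauss_dvd ?pn // prime_coprime.
rewrite -big_split big1_seq //= => d; rewrite mem_filter -dvdn_divisors //.
by case/andP=> npd /(dvdn_gt0 n0) d0; rewrite mobius_mul_prime ?addNr.
Qed.

(** For n odd all the exponents are odd. For n = 2 m, the exponent n / d is even exactly when d
    divides m, so the sign is 2 [d | m] - 1. *)
Lemma sum_mobius_sign n : (0 < n)%N ->
  \sum_(d <- divisors n) mobius d * (-1) ^+ (n %/ d) = 2 *+ (n == 2)%N - (n == 1)%N%:R.
Proof.
move=> n0; case: (boolP (odd n)) => nodd.
  have -> : (n == 2)%N = false by apply/eqP => n2; rewrite n2 in nodd.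
  rewrite mulr0n sub0r -sum_mobius // -sumrN; apply: eq_big_seq => d.
  rewrite -dvdn_divisors // => /dvdnP[m nE]; rewrite nE.
  move: nodd n0; rewrite nE oddM muln_gt0 => /andP[modd _] /andP[_ d0].
  by rewrite mulnK // -signr_odd modd mulrN1.
have [m mE] : exists m, n = m.*2.
  by exists n./2; rewrite -[LHS]odd_double_half (negbTE nodd).
have m0 : (0 < m)%N by rewrite -double_gt0 -mE.
have -> : \sum_(d <- divisors n) mobius d * (-1) ^+ (n %/ d)
    = (\sum_(d <- divisors n | (d %| m)%N) mobius d) *+ 2
      - \sum_(d <- divisors n) mobius d.
  rewrite [in RHS]big_mkcond -sumrMnl -sumrB; apply: eq_big_seq => d.
  rewrite -dvdn_divisors // => dn; have d0 := dvdn_gt0 n0 dn.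
  have -> : (d %| m)%N = ~~ odd (n %/ d).
    by rewrite -dvdn2 dvdn_divRL // mE -muln2 mulnC dvdn_pmul2r.
  by rewrite -signr_odd; case: odd; rewrite ?mul0rn ?mulrN1 ?sub0r // mulr1 mulr2n addrK.
rewrite (@big_divisors_filter _ n m id) //; last first.
  move=> d; split=> [/andP[_ dm]|[e em ->]]; first by exists d.
  by rewrite em mE -muln2 dvdn_mulr.
rewrite !sum_mobius // mE; congr (_ - _).
by case: m m0 {mE} => [|[|m]].
Qed.

(** * The cycle generating function of a finite alphabet *)

Lemma prod_exp_delta (A : comNzRingType) (X : nat -> A) n p e :
  ((0 < e) ==> (0 < p <= n))%N ->
  \prod_(1 <= i < n.+1) X i ^+ ((p == i) * e) = X p ^+ e.
Proof.
case: e => [|e] /= pn.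
  by rewrite big1 ?expr0 // => i _; rewrite muln0 expr0.
rewrite (bigD1_seq p) ?iota_uniq ?mem_index_iota //= eqxx mul1n big1 ?mulr1 //.
by move=> i; rewrite eq_sym => /negbTE ->; rewrite mul0n expr0.
Qed.

Lemma prod_exp_cycles_over (A : comNzRingType) (X : nat -> A) n b p m :
  (0 < p)%N -> (p * m <= n)%N ->
  \prod_(1 <= i < n.+1) X i ^+ cycles_over b p m i
  = if b then X p ^+ odd m * X p.*2 ^+ m./2 else X p ^+ m.
Proof.
move=> p0 pm; have pn : (0 < m)%N -> (p <= n)%N.
  by move=> m0; apply: leq_trans pm; rewrite leq_pmulr.
rewrite /cycles_over; case: b; last first.
  by apply: prod_exp_delta; apply/implyP => m0; rewrite p0 pn.
under eq_bigr => i _ do rewrite exprD.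
rewrite big_split /= !prod_exp_delta //; apply/implyP => m0.
  rewrite double_gt0 p0 /= (leq_trans _ pm) // -muln2 leq_pmul2l //.
  by move: m0; case: m {pm pn} => [|[|m]].
by rewrite p0 pn //; move: m0; case: m {pm pn}.
Qed.

Section StdSeries.
Variables (A : comNzRingType) (q : nat) (neg : pred 'I_q) (n : nat).
Variables (y : 'I_q -> A) (X : nat -> A).
Let L := itin_period n.
Let S := cshift q L.

Lemma prod_wt_itinerary (w : {ffun 'I_n -> 'I_q}) (pi : 'S_n) :
  \prod_k y (w k) = \prod_(c in porbits S)
    orbit_wt y c ^+ (#|[set k | itinerary w pi k \in c]| %/ #|c|).
Proof.
rewrite (reindex_inj (@perm_inj _ (pi^-1)%g)) /=.
transitivity (\prod_k y (letter (itinerary w pi k) 0)).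
  by apply: eq_bigr => k _; rewrite letter_itinerary expg1.
rewrite (partition_big (itinerary w pi) predT) //= (big_porbits _ S) /=.
apply: eq_bigr => c cP; rewrite /orbit_wt -prodrXl; apply: eq_bigr => x xc.
transitivity (y (letter x 0) ^+ #|[set k | itinerary w pi k == x]|).
  rewrite -prodr_const; apply: eq_big => [k|k /eqP -> //]; by rewrite inE.
congr (_ ^+ _); case/imsetP: cP xc => z _ -> xz.
have -> : porbit S z = porbit S x by apply/esym/eqP; rewrite eq_porbit_mem.
rewrite card_over_porbit mulKn //.
by apply: (card_porbits_gt0 (s := S)); apply: imset_f.
Qed.

(** The weight of a word and its cycle monomial both factor over the necklaces, so the bijection
    with the counts turns the sum into the expansion of the product. *)
Lemma std_pairs_series :
  \sum_(wp in std_pairs neg n)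
     (\prod_k y (wp.1 k)) * \prod_(1 <= i < n.+1) X i ^+ num_cycles i wp.2
  = coefs (\prod_(c in porbits S) orbit_fps neg y X c) n.
Proof.
rewrite coefs_prod.
rewrite (bigID (fun N : {ffun _ -> 'I_n.+1} =>
  [forall c in porbits S, #|c| %| N c]%N)) /=.
rewrite [X in _ = _ + X]big1 ?addr0 => [|N]; last first.
  move=> /andP[_]; rewrite negb_forall_in => /exists_inP[c cP cN].
  rewrite (bigD1 c) //= coefs_orbit_fps ?(card_porbits_gt0 cP) //.
  by rewrite (negbTE cN) mul0r.
transitivity (\sum_(N in orbit_count_set q n)
    \prod_(c in porbits S) coefs (orbit_fps neg y X c) (N c)); last first.
  by apply: eq_bigl => N; rewrite [LHS]inE andbA.
rewrite -(orbit_counts_onto neg) big_imset; last exact: orbit_counts_inj.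
apply: eq_bigr => -[w pi]; rewrite inE /= => wpi.
have cycE i : (1 <= i < n.+1)%N ->
    X i ^+ num_cycles i pi = \prod_(c in porbits S) X i ^+ cycles_over
      (orbit_neg neg c) #|c| (#|[set k | itinerary w pi k \in c]| %/ #|c|) i.
  by case/andP=> i0 _; rewrite (num_cycles_std wpi i0) prodrXr.
rewrite (eq_big_nat _ _ cycE) exchange_big /= (prod_wt_itinerary w pi) -big_split.
apply: eq_bigr => c cP /=; have p0 := card_porbits_gt0 cP.
rewrite coefs_orbit_fps // val_orbit_counts //=.
have /imsetP[x _ cE] := cP; rewrite [X in if X then _ else _](_ : _ = true).
  rewrite prod_exp_cycles_over // mulnC divnK.
    by rewrite -[X in (_ <= X)%N]card_ord; apply: max_card.
  by rewrite cE card_over_porbit dvdn_mulr.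
by rewrite cE card_over_porbit dvdn_mulr.
Qed.

End StdSeries.

Lemma prod_periodic (A : comNzRingType) (f : nat -> A) p k :
  (forall t, f (t + p)%N = f t) ->
  \prod_(t < k * p) f t = (\prod_(t < p) f t) ^+ k.
Proof.
move=> fp; elim: k => [|k IHk]; first by rewrite mul0n big_ord0.
rewrite mulSnr big_split_ord /= IHk exprSr; congr (_ * _).
apply: eq_bigr => t _; rewrite addnC.
by elim: k {IHk} => [|k IHk]; rewrite ?mul0n ?addn0 // mulSnr addnA fp.
Qed.

(** * Logarithmic derivative of the product over necklaces *)

Section LogCoef.
Variables (R : numFieldType) (A : comAlgType R) (X : nat -> A).

Definition cycle_coef (P : nat -> R) (i j : nat) : R :=
  \sum_(d <- divisors i) (mobius d)%:~R * P (j * d)%N ^+ (i %/ d).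

(** The coefficient of u^l in the logarithmic derivative of the product of exponentials, with [P] in
    place of the extended power sums: the factors (i, j) that matter are those with i j = l. *)
Definition log_coef (P : nat -> R) (l : nat) : A :=
  \sum_(i <- divisors l) cycle_coef P i (l %/ i) *: X i ^+ (l %/ i).

Variables (q : nat) (neg : pred 'I_q) (L : nat) (y : 'I_q -> R).
Let S := cshift q L.

(** The extended power sum of a finite alphabet without a letter 0. *)
Definition signed_power_sum (m : nat) : R :=
  \sum_a (-1) ^+ (neg a * m.+1) * y a ^+ m.

Let sg (x : cword q L) : R := (-1) ^+ orbit_neg neg (porbit S x).
Let wt (x : cword q L) : R := orbit_wt y (porbit S x).

(** The power expands over the words fixed by the l-th shift. The first l letters of such a word run
    l / p times through its necklace of length p, whence the exponent. *)
Lemma signed_power_sumX l d : (0 < l)%N -> (l %| L.+1)%N ->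
  signed_power_sum d ^+ l
  = \sum_(x | (#|porbit S x| %| l)%N)
      (sg x ^+ d.+1 * wt x ^+ d) ^+ (l %/ #|porbit S x|).
Proof.
move=> l0 lL; rewrite /signed_power_sum -(@sum_cshift_fix q L) //.
apply: eq_big => [x|x]; rewrite porbit_dvd // => pl.
rewrite -porbit_dvd in pl.
pose c a : R := (-1) ^+ (neg a * d.+1) * y a ^+ d.
have -> : sg x ^+ d.+1 * wt x ^+ d = \prod_(t < #|porbit S x|) c (letter x t).
  transitivity (\prod_(z in porbit S x) c (letter z 0)); last first.
    by rewrite big_porbit; apply: eq_bigr => t _; rewrite letter_cshift.
  by rewrite big_split /= prodrXr prodrXl -big_distrl /= exprM /sg signr_odd.
case/dvdnP: (etrans (esym (porbit_dvd S x l)) pl) => k lE.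
have p0 : (0 < #|porbit S x|)%N.
  by apply: (card_porbits_gt0 (s := S)); apply: imset_f.
have -> : (l %/ #|porbit S x|)%N = k by rewrite lE mulnK.
rewrite -(@prod_periodic _ (fun t => c (letter x t))) => [|t]; last first.
  by rewrite letter_fix // permX iter_porbit.
by rewrite -lE.
Qed.

Definition mobius_sign_coef (s : R) (e : nat) : R :=
  \sum_(d <- divisors e) (mobius d)%:~R * s ^+ (e %/ d).

Lemma mobius_sign_coefE (b : bool) e : (0 < e)%N ->
  mobius_sign_coef ((-1) ^+ b) e
  = if b then 2 *+ (e == 2)%N - (e == 1)%N%:R else (e == 1)%N%:R.
Proof.
move=> e0; rewrite /mobius_sign_coef; case: b => /=.
  pose z : int := \sum_(d <- divisors e) mobius d * (-1) ^+ (e %/ d).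
  transitivity (z%:~R : R).
    by rewrite rmorph_sum; apply: eq_bigr => d _; rewrite rmorphM rmorphXn rmorphN1.
  by rewrite /z sum_mobius_sign // rmorphB /= rmorphMn /= !rmorph_nat.
under eq_bigr => d _ do rewrite expr0 expr1n mulr1.
by rewrite -rmorph_sum sum_mobius // rmorph_nat.
Qed.

(** The coefficient of u^(p k) in the logarithmic derivative of the factor of a necklace of length
    p, divided by p: this is the share of each of the p words of its orbit. *)
Definition orbit_log_coef (p k : nat) (b : bool) (Y : R) : A :=
  if b then (if (2 %| k)%N then (Y ^+ k *: X p.*2 ^+ k./2) *+ 2 else 0)
            - ((- Y) ^+ k *: X p ^+ k)
  else Y ^+ k *: X p ^+ k.

(** The left side is what one word of period p adds to [log_coef] in degree p k. By Moebius
    inversion only i = p survives and, if the necklace has oddly many negative letters and k is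
    even, also i = 2 p. *)
Lemma log_coef_porbit p k (b : bool) Y : (0 < p)%N -> (0 < k)%N ->
  \sum_(i <- divisors (p * k)%N | (p %| i)%N)
    (\sum_(d <- divisors i | (p %| i %/ d)%N)
       (mobius d)%:~R * (((-1) ^+ b) ^+ (p * k %/ i * d).+1
                         * Y ^+ (p * k %/ i * d)) ^+ (i %/ d %/ p))
    *: X i ^+ (p * k %/ i)
  = orbit_log_coef p k b Y.
Proof.
move=> p0 k0; have pk0 : (0 < p * k)%N by rewrite muln_gt0 p0.
rewrite (@big_divisors_filter _ _ k (muln p)) //; first last.
- move=> d; split=> [/andP[dpk /dvdnP[e dE]]|[e ek ->]].
    exists e; last by rewrite dE mulnC.
    by rewrite -(dvdn_pmul2l p0) mulnC -dE.
  by rewrite dvdn_pmul2l // ek dvdn_mulr.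
- by move=> a c /eqP; rewrite eqn_pmul2l // => /eqP.
(* With i = p e, the sign has exponent ((k / e) d + 1) (e / d) = k + e / d and Y has exponent k, so
   the sum over d is the Moebius transform at e of the powers of the sign. *)
transitivity (\sum_(e <- divisors k)
    (((-1) ^+ b) ^+ k * mobius_sign_coef ((-1) ^+ b) e * Y ^+ k)
      *: X (p * e)%N ^+ (k %/ e)).
  apply: eq_big_seq => e; rewrite -dvdn_divisors // => ek.
  have e0 := dvdn_gt0 k0 ek.
  rewrite divnMl //; congr (_ *: _).
  rewrite (@big_divisors_filter _ _ e id) //; first last.
  - move=> d; split=> [/andP[dpe pd]|[d' de ->]].
      exists d => //; move: pd; rewrite dvdn_divRL // dvdn_pmul2l //.
    have dpe : (d' %| p * e)%N by rewrite dvdn_mull.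
    by rewrite dpe dvdn_divRL // dvdn_pmul2l.
  - by rewrite muln_gt0 p0.
  rewrite /mobius_sign_coef mulr_sumr mulr_suml; apply: eq_big_seq => d.
  rewrite -dvdn_divisors // => de.
  have -> : (p * e %/ d %/ p = e %/ d)%N.
    by rewrite -muln_divA // mulKn.
  case/dvdnP: ek => k' ->; case/dvdnP: de e0 => e' ->; rewrite muln_gt0 => /andP[e'0 d0].
  have ed0 : (0 < e' * d)%N by rewrite muln_gt0 e'0.
  move: ((-1) ^+ b : R) => s; rewrite !mulnK // exprMn -!exprM.
  rewrite mulSn exprD.
  have -> : (k' * d * e' = k' * (e' * d))%N by rewrite -mulnA [(d * _)%N]mulnC.
  ring.
rewrite (bigD1_seq 1%N) ?divisors_uniq ?div1n //=; last by rewrite -dvdn_divisors.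
rewrite mobius_sign_coefE // divn1 muln1 /orbit_log_coef.
have T0 e : e \in divisors k -> mobius_sign_coef ((-1) ^+ b) e = 0 ->
    (((-1) ^+ b) ^+ k * mobius_sign_coef ((-1) ^+ b) e * Y ^+ k)
      *: X (p * e)%N ^+ (k %/ e) = 0.
  by move=> _ ->; rewrite mulr0 mul0r scale0r.
have divs_gt0 e : e \in divisors k -> (0 < e)%N.
  by rewrite -dvdn_divisors //; apply: dvdn_gt0.
case: b T0 => /= T0; last first.
  rewrite big1_seq ?addr0 => [|e /andP[e1 ek]]; first by rewrite !expr1n !mul1r.
  by apply: T0 => //; rewrite (mobius_sign_coefE false) ?divs_gt0 // (negbTE e1).
rewrite addrC; congr (_ + _); last first.
  by rewrite mulr0n sub0r mulrN1 mulNr scaleNr [in RHS]exprNn expr1.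
have [k2|k2] := boolP (2 %| k)%N; last first.
  apply: big1_seq => e /andP[e1 ek]; apply: T0 => //.
  rewrite (mobius_sign_coefE true) ?divs_gt0 // (negbTE e1) subr0.
  case: eqP => // e2; case/negP: k2; by rewrite -e2 dvdn_divisors.
rewrite -big_filter (bigD1_seq 2%N) ?filter_uniq ?divisors_uniq //=; last first.
  by rewrite mem_filter -dvdn_divisors.
rewrite big1_seq ?addr0 => [|e /andP[e2]]; last first.
  rewrite mem_filter => /andP[e1 ek]; apply: T0 => //.
  by rewrite (mobius_sign_coefE true) ?divs_gt0 // (negbTE e1) (negbTE e2) subr0.
rewrite (mobius_sign_coefE true) // muln2 divn2 expr1 -signr_odd.
have -> : odd k = false by apply/negbTE; rewrite -dvdn2.
by rewrite expr0 mul1r subr0 mulr1n mulr_natl scalerMnl.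
Qed.

End LogCoef.

Section OrbitLog.
Variables (R : numFieldType) (A : comAlgType R) (X : nat -> A).
Variables (q : nat) (neg : pred 'I_q) (L : nat) (y : 'I_q -> R).
Let S := cshift q L.

Lemma coefs_orbit_log (c : {set cword q L}) l : (0 < #|c|)%N -> (0 < l)%N ->
  coefs (orbit_log neg (fun a => (y a)%:A : A) X c) l =
  (if (#|c| %| l)%N
   then orbit_log_coef X #|c| (l %/ #|c|) (orbit_neg neg c) (orbit_wt y c)
   else 0) *+ #|c|.
Proof.
set p := #|c| => p0 l0; rewrite /orbit_log /orbit_log_coef -/p.
have -> : orbit_wt (fun a => (y a)%:A : A) c = (orbit_wt y c)%:A.
  by rewrite /orbit_wt scaler_prod big1_eq.
set Y := orbit_wt y c.
have AX a x k : (a%:A * x) ^+ k = a ^+ k *: x ^+ k :> A by rewrite -exprZn mulr_algl.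
have pl2 : (p.*2 %| l)%N = (p %| l)%N && (2 %| l %/ p)%N.
  apply/idP/andP => [pl|[pl kl]].
    have dpl : (p %| l)%N by apply: dvdn_trans pl; rewrite -muln2 dvdn_mulr.
    by split=> //; rewrite dvdn_divRL // mul2n.
  by move: kl; rewrite dvdn_divRL // mul2n.
case: ifP => _; last first.
  by rewrite /= l0 andbT; case: ifP; rewrite ?mul0rn // AX.
rewrite coefsB /= l0 !andbT pl2; case: (boolP (p %| l)%N) => pl /=;
  last by rewrite subr0 mul0rn.
rewrite mulrnBl.
have -> : - (Y%:A * X p) = (- Y)%:A * X p by rewrite scaleNr mulNr.
rewrite AX; congr (_ - _); case: ifP => k2; last by rewrite mul0rn.
rewrite -mulrnA mul2n; congr (_ *+ _).
have -> : Y%:A ^+ 2 = (Y ^+ 2)%:A :> A by rewrite exprZn expr1n.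
by rewrite -muln2 divnMA divn2 AX -exprM -divn2 mulnC divnK.
Qed.

(** Each orbit is spread evenly over its words. On the other side every power of a power sum is
    expanded over words; after exchanging the sums, the part of a word x is the Moebius sum of
    [log_coef_porbit] if its period divides l, and 0 otherwise. *)
Lemma sum_orbit_log l : (0 < l)%N -> (l %| L.+1)%N ->
  \sum_(c in porbits S) coefs (orbit_log neg (fun a => (y a)%:A : A) X c) l
  = log_coef X (signed_power_sum neg y) l.
Proof.
move=> l0 lL.
pose p x := #|porbit S x|; pose b x := orbit_neg neg (porbit S x).
pose wt x := orbit_wt y (porbit S x).
have p0 x : (0 < p x)%N by apply: (card_porbits_gt0 (s := S)); apply: imset_f.
transitivity (\sum_x (if (p x %| l)%N
    then orbit_log_coef X (p x) (l %/ p x) (b x) (wt x) else 0)).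
  rewrite -(sum_porbits S (fun c : {set cword q L} => if (#|c| %| l)%N
    then orbit_log_coef X #|c| (l %/ #|c|) (orbit_neg neg c) (orbit_wt y c) else 0)).
  by apply: eq_bigr => c cP; rewrite coefs_orbit_log // (card_porbits_gt0 cP).
pose T x i := \sum_(d <- divisors i | (p x %| i %/ d)%N) (mobius d)%:~R
  * (((-1) ^+ b x) ^+ (l %/ i * d).+1 * wt x ^+ (l %/ i * d)) ^+ (i %/ d %/ p x).
have T0 x i : (0 < i)%N -> ~~ (p x %| i)%N -> T x i = 0.
  move=> i0 npi; apply: big1_seq => d /andP[pid]; rewrite -dvdn_divisors // => di.
  by case/negP: npi; apply: dvdn_trans pid _; apply: dvdn_div.
have cycE i : i \in divisors l -> cycle_coef (signed_power_sum neg y) i (l %/ i)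
    = \sum_x T x i.
  rewrite -dvdn_divisors // => il; have i0 := dvdn_gt0 l0 il.
  rewrite /T (exchange_big_dep xpredT) //=; apply: eq_big_seq => d.
  rewrite -dvdn_divisors // => di.
  have d0 := dvdn_gt0 i0 di.
  have id0 : (0 < i %/ d)%N by rewrite divn_gt0 // dvdn_leq.
  have idL : (i %/ d %| L.+1)%N.
    exact: dvdn_trans (dvdn_div di) (dvdn_trans il lL).
  by rewrite (signed_power_sumX neg y _ id0 idL) mulr_sumr.
rewrite /log_coef.
have -> : \sum_(i <- divisors l)
      cycle_coef (signed_power_sum neg y) i (l %/ i) *: X i ^+ (l %/ i)
    = \sum_(i <- divisors l) \sum_x T x i *: X i ^+ (l %/ i).
  by apply: eq_big_seq => i il; rewrite cycE // scaler_suml.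
rewrite exchange_big /=; apply: eq_bigr => x _; case: ifP => [/dvdnP[k lE]|npl].
  move: l0; rewrite {1}lE muln_gt0 => /andP[k0 _].
  have {}lE : l = (p x * k)%N by rewrite lE mulnC.
  rewrite [RHS](bigID (fun i => p x %| i)%N) /= [X in _ + X]big1_seq ?addr0.
    by rewrite /T lE mulKn // log_coef_porbit.
  move=> i /andP[npi]; rewrite -dvdn_divisors ?lE ?muln_gt0 ?p0 // => il.
  by rewrite T0 ?scale0r // (dvdn_gt0 _ il) // muln_gt0 p0.
apply/esym; apply: big1_seq => i; rewrite -dvdn_divisors // => il.
rewrite T0 ?scale0r ?(dvdn_gt0 l0 il) //.
by apply: contraFN npl => /dvdn_trans; apply.
Qed.

End OrbitLog.

Section StdRec.
Variables (R : numFieldType) (A : comAlgType R) (X : nat -> A).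
Variables (q : nat) (neg : pred 'I_q) (y : 'I_q -> R).

Definition std_weight n (pi : 'S_n) : R :=
  \sum_(w : {ffun 'I_n -> 'I_q} | standardizes neg w pi) \prod_k y (w k).

Definition std_mean n : A :=
  \sum_(pi : 'S_n) std_weight pi *: \prod_(1 <= i < n.+1) X i ^+ num_cycles i pi.

Let ya a : A := (y a)%:A.
Let F n := \prod_(c in porbits (cshift q (itin_period n))) orbit_fps neg ya X c.
Let h := log_coef X (signed_power_sum neg y).

Lemma std_mean_coefs n : std_mean n = coefs (F n) n.
Proof.
rewrite /F -std_pairs_series /std_mean.
under eq_bigr => pi _ do rewrite /std_weight scaler_suml.
rewrite (exchange_big_dep xpredT) //= pair_big_dep /=.
apply: eq_big => [[w pi]|[w pi] _] /=; first by rewrite inE.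
by rewrite -mulr_algl; congr (_ * _); rewrite /ya scaler_prod big1_eq.
Qed.

Lemma coefs_orbit_prod0 n : coefs (F n) 0 = 1.
Proof.
rewrite coefs0_prod big1 // => c cP.
rewrite coefs_orbit_fps ?(card_porbits_gt0 cP) // dvdn0 div0n /= expr0 mul1r.
by case: ifP; rewrite !expr0 ?mulr1.
Qed.

Lemma coefs_orbit_prod_rec n k : (k <= n)%N ->
  coefs (F n) k *+ k = \sum_(l < k) h l.+1 * coefs (F n) (k - l.+1)%N.
Proof.
move=> kn; have E : fps_theta (F n) = F n *
    \sum_(c in porbits (cshift q (itin_period n))) orbit_log neg ya X c.
  apply: fps_theta_prod => c cP; apply: fps_theta_orbit.
  exact: card_porbits_gt0 cP.
rewrite (coefs_theta_rec _ E); last first.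
  rewrite coefs_sum big1 // => c _; rewrite /orbit_log.
  by case: ifP => _; rewrite ?coefsB /= !andbF ?subr0.
apply: eq_bigr => l _; congr (_ * _); rewrite coefs_sum sum_orbit_log //.
by rewrite itin_periodE dvdn_fact //= (leq_trans _ kn).
Qed.

Lemma std_mean0 : std_mean 0 = 1.
Proof. by rewrite std_mean_coefs coefs_orbit_prod0. Qed.

(** The product [F n] gives [std_mean] directly in degree n only. For k < n, [F k] and [F n] satisfy
    the same recursion up to degree k, hence have the same coefficient of u^k. *)
Lemma std_mean_rec n :
  std_mean n *+ n = \sum_(l < n) h l.+1 * std_mean (n - l.+1).
Proof.
have E k : (k <= n)%N -> std_mean k = coefs (F n) k.
  move=> kn; rewrite std_mean_coefs.
  apply: (@coefs_rec_unique _ _ _ _ h k) => // [|j jk|j jk].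
  - by rewrite !coefs_orbit_prod0.
  - exact: coefs_orbit_prod_rec.
  - by apply: coefs_orbit_prod_rec; apply: leq_trans kn.
rewrite E // coefs_orbit_prod_rec //; apply: eq_bigr => l _.
by rewrite E // leq_subr.
Qed.

End StdRec.

(** * The letter 0 as a limit of positive letters *)

Lemma card_perm_lt n (pi : 'S_n) a : (a <= n)%N -> #|[set j | (pi j < a)%N]| = a.
Proof.
move=> an; rewrite -sum1_card (reindex_inj (@perm_inj _ (pi^-1)%g)) /=.
rewrite (eq_bigl (fun i : 'I_n => (i < a)%N)) => [|i]; last by rewrite inE permKV.
by rewrite -(big_ord_widen _ (fun=> 1%N)) // sum1_card card_ord.
Qed.

(** A permutation takes exactly a values below a, so prescribing the interval of values of each
    letter amounts to prescribing the order between letters. *)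
Lemma in_blocksP n (w : {ffun 'I_n -> int}) (pi : 'S_n) :
  reflect (forall k l, w k < w l -> (pi k < pi l)%N) (in_blocks w pi).
Proof.
have cardD k : (#|[set j | (w j < w k)%R]| + #|[set j | w j == w k]|)%N
    = #|[set j | w j <= w k]|.
  rewrite -cardsUI [X in (_ + X)%N](_ : _ = 0%N) ?addn0.
    by apply: eq_card => j; rewrite !inE le_eqVlt orbC.
  by apply: eq_card0 => j; rewrite !inE; case: ltgtP.
apply: (iffP forallP) => [wpi k l wkl|wpi k].
  have /andP[_] := wpi k; have /andP[+ _] := wpi l; rewrite cardD => hl hk.
  apply: leq_trans hk (leq_trans _ hl); apply: subset_leq_card.
  by apply/fintype.subsetP => j; rewrite !inE => /le_lt_trans; apply.
rewrite /= cardD; apply/andP; split.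
  have := card_perm_lt pi (ltnW (ltn_ord (pi k))) => <-.
  apply: subset_leq_card; apply/fintype.subsetP => j; rewrite !inE.
  exact: wpi.
have := card_perm_lt pi (ltn_ord (pi k)) => <-.
apply: subset_leq_card; apply/fintype.subsetP => j; rewrite !inE ltnS => jk.
by rewrite leNgt; apply/negP => /wpi; rewrite ltnNge jk.
Qed.

Lemma ordered_in_blocksP n (w : {ffun 'I_n -> int}) (pi : 'S_n) :
  reflect (forall k l : 'I_n, (k < l)%N -> w k = w l ->
     (0 < w k -> (pi k < pi l)%N) /\ (w k < 0 -> (pi l < pi k)%N))
  (ordered_in_blocks w pi).
Proof.
apply: (iffP forallP) => [wpi k l kl wkl|wpi k].
  have /forallP/(_ l) := wpi k; rewrite kl wkl eqxx /=.
  by case/andP=> /implyP h1 /implyP h2.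
apply/forallP => l; apply/implyP => /andP[kl /eqP wkl].
by have [h1 h2] := wpi k l kl wkl; apply/andP; split; apply/implyP.
Qed.

Section Refinement.
Variables (N n : nat).

(* The letters a < N, N <= a < 2N and a >= 2N stand for the integers -N .. -1,
   for N copies of 0, and for 1 .. N. *)
Definition alphabet := 'I_(N + N + N).

Definition letter_val (a : alphabet) : int :=
  if (a < N)%N then Negz (N - a.+1) else if (a < N + N)%N then 0
  else Posz (a - (N + N)).+1.

Definition letter_neg (a : alphabet) : bool := (a < N)%N.

Definition word_val (w : {ffun 'I_n -> alphabet}) : {ffun 'I_n -> int} :=
  [ffun k => letter_val (w k)].

Lemma letter_val_le (a b : alphabet) : (a <= b)%N -> letter_val a <= letter_val b.
Proof. by rewrite /letter_val => ab; repeat case: ifP => ?; lia. Qed.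

Lemma letter_val_lt (a b : alphabet) : letter_val a < letter_val b -> (a < b)%N.
Proof. by move=> ab; rewrite ltnNge; apply/negP => /letter_val_le; rewrite leNgt ab. Qed.

Lemma letter_val_inj (a b : alphabet) :
  letter_val a != 0 -> letter_val a = letter_val b -> a = b.
Proof.
move=> a0 ab; apply: val_inj => /=; move: a0 ab; rewrite /letter_val.
have := ltn_ord a; have := ltn_ord b; rewrite -/alphabet.
by repeat case: ifP => ?; lia.
Qed.

Lemma letter_val_neg a : (letter_val a < 0) = letter_neg a.
Proof. by rewrite /letter_val /letter_neg; repeat case: ifP => ?; lia. Qed.

Lemma letter_val_eq0 a : (letter_val a == 0) = (N <= a < N + N)%N.
Proof. by rewrite /letter_val; repeat case: ifP => ?; lia. Qed.

Lemma standardizes_word_val (w : {ffun 'I_n -> alphabet}) (pi : 'S_n) :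
  standardizes letter_neg w pi ->
  in_blocks (word_val w) pi && ordered_in_blocks (word_val w) pi.
Proof.
move=> wpi; apply/andP; split.
  apply/in_blocksP => k l; rewrite !ffunE => /letter_val_lt.
  by apply: (proj1 (stdP wpi _ _)).
apply/ordered_in_blocksP => k l kl; rewrite !ffunE => wkl.
split=> wk.
  have E : w k = w l by apply: letter_val_inj wkl; rewrite gt_eqF.
  by have := proj2 (stdP wpi _ _) kl E; rewrite -letter_val_neg ltNge (ltW wk).
have E : w k = w l by apply: letter_val_inj wkl; rewrite lt_eqF.
by have := proj2 (stdP wpi _ _) kl E; rewrite -letter_val_neg wk.
Qed.



End Refinement.

Lemma ffact_leq_exp n m k : (n <= k)%N -> (n ^_ m <= k ^ m)%N.
Proof.
move=> nk; rewrite ffact_prod -[m in (_ ^ m)%N]card_ord -prod_nat_const.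
by apply: leq_prod => i _; apply: leq_trans (leq_subr _ _) nk.
Qed.

Lemma leq_exp_ffact n m k : (m <= k)%N -> ((n - k) ^ m <= n ^_ m)%N.
Proof.
move=> mk; rewrite ffact_prod -[m in (_ ^ m)%N]card_ord -prod_nat_const.
apply: leq_prod => i _; apply: leq_sub2l; apply: leq_trans mk.
exact: ltnW.
Qed.

Section RefinementCount.
Variables (N' n : nat).
Let N := N'.+1.
Variables (u : {ffun 'I_n -> int}) (pi : 'S_n).

Definition refinements : {set {ffun 'I_n -> alphabet N}} :=
  [set w | standardizes (@letter_neg N) w pi & word_val w == u].

Let m := #|[set k | u k == 0]|.
(* The positions of the letter 0, in the order of their images by pi. *)
Let zs := [seq (pi^-1)%g i | i <- enum 'I_n & u ((pi^-1)%g i) == 0].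

Let mem_zs k : (k \in zs) = (u k == 0).
Proof.
apply/mapP/idP => [[i + ->]|uk]; first by rewrite mem_filter => /andP[].
by exists (pi k); rewrite ?permK // mem_filter permK uk mem_enum.
Qed.

Let uniq_zs : uniq zs.
Proof. by rewrite (map_inj_uniq (@perm_inj _ (pi^-1)%g)) filter_uniq ?enum_uniq. Qed.

Let size_zs : size zs = m.
Proof.
rewrite /m -(card_uniqP uniq_zs); apply: eq_card => k.
by rewrite mem_zs inE.
Qed.

Let sorted_zs : sorted (fun k l => pi k < pi l)%N zs.
Proof.
have -> : sorted (fun k l => pi k < pi l)%N zs
    = sorted ltn [seq (pi k : nat) | k <- zs] by rewrite sorted_map.
rewrite -map_comp.
rewrite (eq_map (g := val)) => [|i /=]; last by rewrite permKV.
rewrite sorted_map; apply: sorted_filter; first by move=> a b c; apply: ltn_trans.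
by rewrite -sorted_map val_enum_ord iota_ltn_sorted.
Qed.

(** Outside the zeros of u the letters are forced. On the zeros, listed by increasing pi, they form
    a weakly increasing sequence among N letters, and ['C(m + N', m)] counts these. This bound and
    the next are both equivalent to N^m / m!, which is where the factor 1 / m! of [fill_prob] comes
    from. *)
Lemma card_refinements_le : (#|refinements| <= 'C(m + N', m))%N.
Proof.
pose f (w : {ffun 'I_n -> alphabet N}) : (size zs).-tuple 'I_N'.+1 :=
  map_tuple (fun k => inord (w k - N)) (in_tuple zs).
have zero w k : w \in refinements -> u k == 0 -> (N <= w k < N + N)%N.
  by rewrite inE => /andP[_ /eqP <-]; rewrite ffunE letter_val_eq0.
have finj : {in refinements &, injective f}.
  move=> w w' wr wr' /(congr1 val) /= /eq_in_map ww'; apply/ffunP => k.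
  case: (boolP (u k == 0)) => uk.
    have := ww' k; rewrite mem_zs uk => /(_ isT) /(congr1 val) /=.
    have := zero _ _ wr uk; have := zero _ _ wr' uk.
    move=> /andP[h1 h2] /andP[h3 h4]; rewrite !inordK ?ltn_subLR // => E.
    by apply: val_inj; rewrite /= -(subnK h1) -E subnK.
  move: wr wr'; rewrite !inE => /andP[_ /eqP wE] /andP[_ /eqP wE'].
  apply: letter_val_inj; first by move: uk; rewrite -wE ffunE.
  by have := congr1 (fun v : {ffun _} => v k) (etrans wE (esym wE')); rewrite !ffunE.
rewrite -(card_in_imset finj) -size_zs -card_sorted_tuples.
apply: subset_leq_card; apply/fintype.subsetP => t /imsetP[w wr ->].
rewrite inE /= -map_comp.
apply: (@homo_sorted_in _ _ (fun k => u k == 0) _ (fun k l => pi k < pi l)%N); last first.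
- exact: sorted_zs.
- by apply/allP => k; rewrite mem_zs.
move=> k l uk ul kl /=.
have := zero _ _ wr uk; have := zero _ _ wr ul => /andP[h1 h2] /andP[h3 h4].
rewrite !inordK ?ltn_subLR //; apply: leq_sub2r; rewrite leqNgt; apply/negP => wlk.
move: wr; rewrite inE => /andP[/stdP/(_ l k)[/(_ wlk) + _] _].
by rewrite ltnNge ltnW.
Qed.

Hypothesis upi : in_blocks u pi && ordered_in_blocks u pi.
Hypothesis u_word : exists v : {ffun 'I_n -> alphabet N}, word_val v = u.

(** A strictly increasing choice of letters on the zeros has no ties there to break, so it is always
    standardized by pi. *)
Lemma card_refinements_ge : ('C(N, m) <= #|refinements|)%N.
Proof.
have [v vu] := u_word.
case/andP: upi => /in_blocksP ub /ordered_in_blocksP uo.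
rewrite -size_zs -card_ltn_sorted_tuples; set Ts := finset _.
pose z (t : 'I_N) : alphabet N := lshift N (rshift N t).
pose g (t : (size zs).-tuple 'I_N) : {ffun 'I_n -> alphabet N} :=
  [ffun k => if u k == 0 then z (nth ord0 t (index k zs)) else v k].
have ginj : injective g.
  move=> t t' /ffunP tt'; apply: eq_from_tnth => i.
  have ilt := ltn_ord i; have := tt' (tnth (in_tuple zs) i).
  rewrite !ffunE -mem_zs mem_tnth (tnth_nth (tnth (in_tuple zs) i)) /=.
  rewrite index_uniq // => /(congr1 val) /= /eqP; rewrite eqn_add2l => /eqP/val_inj.
  by rewrite -!tnth_nth.
rewrite -(card_imset _ ginj); apply: subset_leq_card.
apply/fintype.subsetP => w /imsetP[t]; rewrite inE => tsort ->.
have zval s : letter_val (z s) = 0.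
  by apply/eqP; rewrite letter_val_eq0 /= leq_addr ltn_add2l /=.
have gval k : letter_val (g t k) = u k.
  by rewrite ffunE; case: ifP => [/eqP ->|_]; rewrite ?zval // -vu ffunE.
have idx k : u k == 0 -> (index k zs < size zs)%N.
  by move=> uk; rewrite index_mem mem_zs.
have gz k : u k == 0 -> g t k = (N + nth ord0 t (index k zs))%N :> nat.
  by move=> uk; rewrite ffunE uk.
have tlt i j : (i < j < size zs)%N -> (nth ord0 t i < nth ord0 t j)%N.
  case/andP=> ij jm; have im := ltn_trans ij jm.
  rewrite -!(nth_map _ 0%N val) ?size_tuple //.
  by apply: (sorted_ltn_nth ltn_trans 0%N tsort); rewrite ?inE ?size_map ?size_tuple.
have g_lt k l : u k == 0 -> u l == 0 -> (g t k < g t l)%N -> (pi k < pi l)%N.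
  move=> uk ul; rewrite !gz // ltn_add2l => tkl.
  have rT : transitive (fun k l : 'I_n => pi k < pi l)%N.
    by move=> a b c; apply: ltn_trans.
  apply: (sorted_ltn_index rT sorted_zs); rewrite ?mem_zs //.
  case: (ltngtP (index k zs) (index l zs)) => // E.
    by have := tlt _ _ (introT andP (conj E (idx _ uk))); rewrite ltnNge ltnW.
  by move: tkl; rewrite E ltnn.
have g_inj k l : u k == 0 -> u l == 0 -> g t k = g t l -> k = l.
  move=> uk ul /(congr1 val); rewrite /= !gz // => /eqP; rewrite eqn_add2l => /eqP tkl.
  have kz : k \in zs by rewrite mem_zs.
  have lz : l \in zs by rewrite mem_zs.
  rewrite -(nth_index k kz) -(nth_index k lz); congr nth.
  case: (ltngtP (index k zs) (index l zs)) => // E.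
    by have := tlt _ _ (introT andP (conj E (idx _ ul))); rewrite tkl ltnn.
  by have := tlt _ _ (introT andP (conj E (idx _ uk))); rewrite tkl ltnn.
rewrite inE; apply/andP; split; last by apply/eqP/ffunP => k; rewrite ffunE gval.
apply/forallP => k; apply/forallP => l; apply/andP; split; apply/implyP.
  move=> gkl; have := letter_val_le (ltnW gkl).
  rewrite !gval le_eqVlt => /orP[/eqP ukl|/ub //].
  have [uk|uk] := eqVneq (u k) 0; first by apply: g_lt; rewrite -?ukl ?uk.
  have E : g t k = g t l by apply: letter_val_inj; rewrite !gval.
  by rewrite E ltnn in gkl.
case/andP=> kl /eqP gkl; have ukl : u k = u l by rewrite -!gval gkl.
have [uk|uk] := eqVneq (u k) 0.
  by rewrite (g_inj k l) ?ltnn -?ukl ?uk // in kl.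
have [h1 h2] := uo k l kl ukl.
rewrite -letter_val_neg gval; case: ifP => un; first exact: h2.
by apply: h1; rewrite lt_def uk leNgt un.
Qed.

End RefinementCount.

(** * Infinite sums over words as limits *)

Section EsumLimit.
Local Open Scope classical_set_scope.

Lemma ler_sum_uniq (R : numDomainType) (T : eqType) (g : T -> R) (s r : seq T) :
  (forall x, 0 <= g x) -> uniq s -> uniq r -> {subset s <= r} ->
  \sum_(x <- s) g x <= \sum_(x <- r) g x.
Proof.
move=> g0 us ur sr.
have -> : \sum_(x <- s) g x = \sum_(x <- r | x \in s) g x.
  rewrite -[RHS]big_filter; apply: perm_big; apply: uniq_perm => //.
    exact: filter_uniq.
  by move=> x; rewrite mem_filter; case xs: (x \in s); rewrite // sr.
by rewrite [leRHS](bigID (mem s)) /= lerDl; apply: sumr_ge0.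
Qed.

(** The infinite sum is a supremum over finite sets, and each finite set lies in [W N] for large N.
    The bound B keeps the supremum finite, so that [fine] returns its value. *)
Lemma cvg_sum_esum (R : realType) (T : choiceType) (g : T -> R)
    (W : nat -> seq T) (B : R) :
  (forall x, 0 <= g x) -> (forall N, uniq (W N)) ->
  (forall x, exists M, forall N, (M <= N)%N -> x \in W N) ->
  (forall N, \sum_(x <- W N) g x <= B) ->
  (fun N => \sum_(x <- W N) g x) @ \oo
    --> fine (\esum_(x in [set: T]) (g x)%:E).
Proof.
move=> g0 uW exW leB; set e := \esum_(x in _) _.
have W_le N : ((\sum_(x <- W N) g x)%:E <= e)%E.
  apply: esum_ge; exists [set` W N]; first by split=> //; apply: finite_seq.
  by rewrite -fsbig_seq // sumEFin.
have F_le F : fsets [set: T] F -> exists M, forall N, (M <= N)%N ->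
    (\sum_(x \in F) (g x)%:E <= (\sum_(x <- W N) g x)%:E)%E.
  move=> [finF _]; have [M MP] : exists M, forall N, (M <= N)%N ->
      {subset (fset_set F : seq T) <= W N}.
    elim: (fset_set F : seq T) => [|x s [M IHM]]; first by exists 0%N => N _ z.
    have [M' MP'] := exW x; exists (maxn M M') => K; rewrite geq_max => /andP[h1 h2].
    by move=> z; rewrite inE => /orP[/eqP->|zs]; [apply: MP' | apply: IHM].
  exists M => N MN; rewrite fsbig_finite //= sumEFin lee_fin.
  by apply: ler_sum_uniq => //; apply: MP.
have e_le : (e <= B%:E)%E.
  apply: ge_ereal_sup => _ [F /F_le[M MP] <-].
  by apply: le_trans (MP M (leqnn M)) _; rewrite lee_fin.
have e_fin : e \is a fin_num.
  rewrite ge0_fin_numE; first exact: le_lt_trans e_le (ltry _).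
  by apply: esum_ge0 => x _; rewrite lee_fin.
apply/cvgrPdist_le => eps eps0.
have [_ [F FS <-] ltF] := ub_ereal_sup_adherent eps0 e_fin.
have [M MP] := F_le F FS; exists M => // N /= MN.
have := W_le N; have := lt_le_trans ltF (MP N MN); rewrite -[ereal_sup _]/e.
have [r er] : exists r, e = r%:E by exists (fine e); rewrite fineK.
rewrite er /= -EFinB lte_fin lee_fin => h1 h2.
by rewrite ger0_norm ?subr_ge0 // lerBlDr -lerBlDl ltW.
Qed.

End EsumLimit.

Lemma sum_seq_partition (R : nmodType) (I : finType) (J : eqType) (f : I -> J)
    (W : seq J) (P : pred I) (F : I -> R) :
  uniq W -> (forall i, f i \in W) ->
  \sum_(i | P i) F i = \sum_(u <- W) \sum_(i | P i && (f i == u)) F i.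
Proof.
move=> uW fW; rewrite (exchange_big_dep P) => [|u i _ /andP[]] //=.
apply: eq_bigr => i Pi; rewrite Pi /=.
rewrite -big_filter (_ : [seq _ <- _ | _] = [:: f i]) ?big_seq1 //.
rewrite -(filter_pred1_uniq uW (fW i)); apply: eq_filter => u.
by rewrite /= eq_sym.
Qed.

Definition bounded_int N (j : 'I_(N + N.+1)) : int :=
  if (j < N)%N then Negz (N - j.+1) else Posz (j - N).

Lemma bounded_int_inj N : injective (@bounded_int N).
Proof.
move=> i j; rewrite /bounded_int => E; apply: val_inj => /=.
by have := ltn_ord i; have := ltn_ord j; move: E; do 2!case: ifP; lia.
Qed.

Definition bounded_words n N : seq {ffun 'I_n -> int} :=
  [seq [ffun k => bounded_int (v k)] | v : {ffun 'I_n -> 'I_(N + N.+1)}].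

Lemma uniq_bounded_words n N : uniq (bounded_words n N).
Proof.
rewrite map_inj_uniq ?enum_uniq // => v v' /ffunP vv'; apply/ffunP => k.
by have := vv' k; rewrite !ffunE => /bounded_int_inj.
Qed.

Lemma bounded_wordsP n N (u : {ffun 'I_n -> int}) :
  reflect (forall k, (`|u k| <= N)%N) (u \in bounded_words n N).
Proof.
apply: (iffP mapP) => [[v _ ->] k|uN].
  rewrite ffunE; move: (v k) => j; rewrite /bounded_int; have := ltn_ord j.
  by case: ifP => /= ? ?; lia.
have ex k : (`|(u k + N%:Z)%R| < N + N.+1)%N.
  by have := uN k; move: (u k) => z; lia.
exists [ffun k => Ordinal (ex k)]; rewrite ?mem_enum //.
apply/ffunP => k; rewrite !ffunE /bounded_int /=; have := uN k.
by move: (u k) => z; case: ifP => ? ?; lia.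
Qed.

Lemma fill_prob_ge0 (R : realType) n (u : {ffun 'I_n -> int}) (pi : 'S_n) :
  0 <= fill_prob R u pi.
Proof. by rewrite /fill_prob; case: ifP => // _; rewrite invr_ge0. Qed.

Lemma fill_prob_le1 (R : realType) n (u : {ffun 'I_n -> int}) (pi : 'S_n) :
  fill_prob R u pi <= 1.
Proof.
rewrite /fill_prob; case: ifP => // _.
by rewrite invf_le1 ?ler1n ?ltr0n ?fact_gt0.
Qed.

Section WordSums.
Variables (R : realType) (alpha beta : nat -> R) (gamma : R).
Let lp := letter_prob alpha beta gamma.

Lemma sum_bounded_int N :
  \sum_j lp (@bounded_int N j) = \sum_(i < N) alpha i + gamma + \sum_(i < N) beta i.
Proof.
rewrite big_split_ord /= addrC; congr (_ + _); last first.
  rewrite (reindex_inj rev_ord_inj); apply: eq_bigr => i _.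
  rewrite /bounded_int /= ifT; last by have := ltn_ord i; lia.
  by rewrite /lp /=; congr beta; have := ltn_ord i; lia.
rewrite big_ord_recl /= /bounded_int /= addn0 ltnn subnn addrC; congr (_ + _).
apply: eq_bigr => i _; rewrite ifF; last by rewrite /= /bump; lia.
by rewrite addKn.
Qed.

Lemma sum_word_prob n N :
  \sum_(u <- bounded_words n N) word_prob alpha beta gamma u
  = (\sum_(i < N) alpha i + gamma + \sum_(i < N) beta i) ^+ n.
Proof.
rewrite -sum_bounded_int -[n in RHS]card_ord -prodr_const bigA_distr_bigA /=.
rewrite /bounded_words big_image /=; apply: eq_bigr => v _.
by apply: eq_bigr => k _; rewrite ffunE.
Qed.

Definition alphabet_prob N (a : alphabet N) : R :=
  lp (letter_val a) * (if letter_val a == 0 then N%:R^-1 else 1).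

(** Words over the refined alphabet are grouped by the integer word that they spell; the number of
    refinements divided by N^m then stands where the shuffle has [fill_prob]. *)
Lemma std_weight_refinements n (pi : 'S_n) N' :
  std_weight (@letter_neg N'.+1) (@alphabet_prob N'.+1) pi
  = \sum_(u <- bounded_words n N'.+1) word_prob alpha beta gamma u
      * (#|refinements N' u pi|%:R / N'.+1%:R ^+ #|[set k | u k == 0]|).
Proof.
rewrite /std_weight (@sum_seq_partition _ _ _ (@word_val N'.+1 n)
  (bounded_words n N'.+1)) ?uniq_bounded_words //; last first.
  move=> w; apply/bounded_wordsP => k; rewrite ffunE.
  move: (w k) => a; have := ltn_ord a; rewrite /letter_val.
  by repeat case: ifP => /= ?; lia.
apply: eq_bigr => u _.
transitivity (\sum_(w in refinements N' u pi)
    word_prob alpha beta gamma u / N'.+1%:R ^+ #|[set k | u k == 0]|).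
  apply: eq_big => [w|w /andP[_ /eqP <-]]; first by rewrite inE.
  rewrite /alphabet_prob big_split /= /word_prob; congr (_ * _).
    by apply: eq_bigr => k _; rewrite ffunE.
  rewrite -exprVn -big_mkcond prodr_const; congr (_ ^+ _).
  by apply: eq_card => k; rewrite !inE ffunE.
by rewrite sumr_const -[LHS]mulr_natr -mulrA [_^-1 * _]mulrC.
Qed.

Hypothesis alpha0 : forall i, 0 <= alpha i.
Hypothesis beta0 : forall i, 0 <= beta i.
Hypothesis gamma0 : 0 <= gamma.
Hypothesis sum_le1 : forall N,
  \sum_(i < N) alpha i + gamma + \sum_(i < N) beta i <= 1.

Lemma letter_prob_ge0 z : 0 <= lp z.
Proof. by case: z => [[|i]|i] /=. Qed.

Lemma word_prob_ge0 n (u : {ffun 'I_n -> int}) : 0 <= word_prob alpha beta gamma u.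
Proof. by apply: prodr_ge0 => k _; apply: letter_prob_ge0. Qed.

Section Perm.
Variables (n : nat) (pi : 'S_n).
Let g u := word_prob alpha beta gamma u * fill_prob R u pi.

Lemma bounded_shuffle_le1 N : \sum_(u <- bounded_words n N) g u <= 1.
Proof.
apply: le_trans (_ : \sum_(u <- bounded_words n N) word_prob alpha beta gamma u <= _).
  apply: ler_sum => u _; rewrite ler_piMr ?word_prob_ge0 //.
  exact: fill_prob_le1.
rewrite sum_word_prob exprn_ile1 ?sum_le1 //.
by rewrite !addr_ge0 // sumr_ge0.
Qed.

Lemma cvg_bounded_shuffle :
  ((fun N => \sum_(u <- bounded_words n N.+1) g u) @ \oo
    --> shuffle_prob alpha beta gamma pi)%classic.
Proof.
apply: (@cvg_sum_esum R _ g (fun N => bounded_words n N.+1) 1).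
- by move=> u; rewrite mulr_ge0 ?word_prob_ge0 ?fill_prob_ge0.
- by move=> N; apply: uniq_bounded_words.
- move=> u; exists (\max_k `|u k|%N) => N uN; apply/bounded_wordsP => k.
  by apply: leqW; apply: leq_trans uN; apply: (leq_bigmax k).
- by move=> N; apply: bounded_shuffle_le1.
Qed.

End Perm.

End WordSums.

Section SeqLimits.
Local Open Scope classical_set_scope.
Variable R : realType.
Implicit Types f : nat -> R.

Lemma cvg_seq_sum (I : eqType) (r : seq I) (f : I -> nat -> R) (l : I -> R) :
  (forall i, i \in r -> f i @ \oo --> l i) ->
  (fun N => \sum_(i <- r) f i N) @ \oo --> \sum_(i <- r) l i.
Proof.
elim: r => [|i r IHr] fl.
  rewrite big_nil (_ : (fun _ => _) = fun=> 0); first exact: cvg_cst.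
  by apply/funext => N; rewrite big_nil.
rewrite big_cons (_ : (fun _ => _) = fun N => f i N + \sum_(i <- r) f i N).
  apply: cvgD; first by apply: fl; rewrite mem_head.
  by apply: IHr => j jr; apply: fl; rewrite inE jr orbT.
by apply/funext => N; rewrite big_cons.
Qed.

Lemma cvg_seq_exp f (l : R) k : f @ \oo --> l -> (fun N => f N ^+ k) @ \oo --> l ^+ k.
Proof.
move=> fl; elim: k => [|k IHk].
  rewrite expr0 (_ : (fun _ => _) = fun=> 1); first exact: cvg_cst.
  by apply/funext => N; rewrite expr0.
rewrite exprS (_ : (fun _ => _) = fun N => f N * f N ^+ k); first exact: cvgM.
by apply/funext => N; rewrite exprS.
Qed.

Lemma cvg_one_add_div (c : R) k :
  (fun N => (1 + c / N.+1%:R) ^+ k : R) @ \oo --> (1 : R).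
Proof.
rewrite -[X in _ --> X](expr1n _ k); apply: cvg_seq_exp.
rewrite -[X in _ --> X]addr0 -[X in _ + X](mulr0 c).
apply: cvgD; first exact: cvg_cst.
by apply: cvgM; [exact: cvg_cst | exact: cvg_harmonic].
Qed.

End SeqLimits.

Section WordLimit.
Local Open Scope classical_set_scope.
Variables (R : realType) (alpha beta : nat -> R) (gamma : R).
Hypothesis alpha0 : forall i, 0 <= alpha i.
Hypothesis beta0 : forall i, 0 <= beta i.
Hypothesis gamma0 : 0 <= gamma.
Hypothesis sum_le1 : forall N,
  \sum_(i < N) alpha i + gamma + \sum_(i < N) beta i <= 1.

Section Perm.
Variables (n : nat) (pi : 'S_n).
Let sw N := std_weight (@letter_neg N.+1) (@alphabet_prob _ alpha beta gamma N.+1) pi.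

(** The exponent is n instead of the number m of zeros: the factors then do not depend on u and can
    be taken out of the sum over words. *)
Lemma card_refinements_bounds N (u : {ffun 'I_n -> int}) :
  (n <= N)%N -> (forall k, (`|u k| <= N.+1)%N) ->
  (1 + - n%:R / N.+1%:R) ^+ n * fill_prob R u pi
    <= #|refinements N u pi|%:R / N.+1%:R ^+ #|[set k | u k == 0]%SET|
    <= (1 + n%:R / N.+1%:R) ^+ n * fill_prob R u pi.
Proof.
move=> nN uN; rewrite /fill_prob; case: ifP => upi; last first.
  have -> : refinements N u pi = finset.set0.
    apply/setP => w; rewrite !inE; apply/negP => /andP[/standardizes_word_val h /eqP wu].
    by move: h; rewrite wu upi.
  by rewrite cards0 mul0r !mulr0 lexx.
set m := #|_|; have mn : (m <= n)%N by rewrite -[n]card_ord max_card.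
have N0 : (0 : R) < N.+1%:R by rewrite ltr0n.
have m0 : (0 : R) < m`!%:R by rewrite ltr0n fact_gt0.
have ratioE (x : R) : (1 + x / N.+1%:R) ^+ m = (N.+1%:R + x) ^+ m / N.+1%:R ^+ m.
  by rewrite -expr_div_n mulrDl divff // gt_eqF.
have nN1 : (n%:R : R) <= N.+1%:R by rewrite ler_nat (leq_trans nN).
have u_word : exists v : {ffun 'I_n -> alphabet N.+1}, word_val v = u.
  have ex k : exists a : alphabet N.+1, letter_val a == u k.
    have := uN k; move: (u k) => z zN.
    have [z0|z0] := ltrP z 0.
      have zlt : (`|(N.+1%:Z + z)%R| < N.+1 + N.+1 + N.+1)%N by lia.
      by exists (Ordinal zlt); rewrite /letter_val /= ifT; lia.
    have zlt : (`|(N.*2.+1%:Z + z)%R| < N.+1 + N.+1 + N.+1)%N by lia.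
    exists (Ordinal zlt); rewrite /letter_val /= ifF; last by lia.
    by case: ifP => h; lia.
  exists [ffun k => xchoose (ex k)]; apply/ffunP => k; rewrite !ffunE.
  exact/eqP/(xchooseP (ex k)).
apply/andP; split.
  apply: (@le_trans _ _ ((1 + - n%:R / N.+1%:R) ^+ m / m`!%:R)).
    rewrite ler_pM2r ?invr_gt0 //; apply: ler_wiXn2l => //.
      by rewrite mulNr subr_ge0 ler_pdivrMr // mul1r.
  rewrite ratioE mulrAC ler_pM2r ?invr_gt0 ?exprn_gt0 // ler_pdivrMr //.
  rewrite -natrM -natrB ?(leq_trans nN) // -natrX ler_nat.
  apply: (@leq_trans ('C(N.+1, m) * m`!)%N); last first.
    by rewrite leq_mul2r card_refinements_ge // orbT.
  by rewrite bin_ffact leq_exp_ffact.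
apply: (@le_trans _ _ ((1 + n%:R / N.+1%:R) ^+ m / m`!%:R)); last first.
  rewrite ler_pM2r ?invr_gt0 //; apply: ler_weXn2l => //.
  by rewrite lerDl divr_ge0.
rewrite ratioE mulrAC ler_pM2r ?invr_gt0 ?exprn_gt0 // ler_pdivlMr //.
rewrite -natrM -natrD -natrX ler_nat.
apply: (@leq_trans ('C(m + N, m) * m`!)%N).
  by rewrite leq_mul2r card_refinements_le orbT.
by rewrite bin_ffact ffact_leq_exp // addnC leq_add.
Qed.

Lemma cvg_std_weight : sw @ \oo --> shuffle_prob alpha beta gamma pi.
Proof.
have T := cvg_bounded_shuffle alpha0 beta0 gamma0 sum_le1 (pi := pi).
set S := fun N : nat => _ in T.
have lim c : (fun N => (1 + c / N.+1%:R) ^+ n * S N) @ \oo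
    --> shuffle_prob alpha beta gamma pi.
  rewrite -[X in _ --> X]mul1r; apply: cvgM => //; exact: cvg_one_add_div.
apply: (squeeze_cvgr _ (lim (- n%:R)) (lim n%:R)).
exists n => // N /= nN; rewrite /sw std_weight_refinements /S.
rewrite !mulr_sumr; apply/andP; split; rewrite big_seq [leRHS]big_seq;
  apply: ler_sum => u /bounded_wordsP uN;
  have /andP[h1 h2] := card_refinements_bounds nN uN.
  by rewrite mulrCA; apply: ler_wpM2l => //; apply: word_prob_ge0.
by rewrite [leRHS]mulrCA; apply: ler_wpM2l => //; apply: word_prob_ge0.
Qed.

End Perm.
End WordLimit.

(** * Limits of the power sums *)

Section PowerSumLimit.
Local Open Scope classical_set_scope.
Variables (R : realType) (alpha beta : nat -> R) (gamma : R).

Lemma signed_power_sum_alphabet N m :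
  signed_power_sum (@letter_neg N) (@alphabet_prob R alpha beta gamma N) m
  = \sum_(i < N) alpha i ^+ m + (-1) ^+ m.+1 * \sum_(i < N) beta i ^+ m
    + N%:R * (gamma / N%:R) ^+ m.
Proof.
rewrite /signed_power_sum big_split_ord /= addrC -addrA; congr (_ + _).
  apply: eq_bigr => i _; rewrite /alphabet_prob /letter_neg /letter_val /=.
  do 2![rewrite ifF; last by lia]; rewrite /= mulr1.
  rewrite [(N + N + i < N)%N](_ : _ = false) ?mul1r; last by lia.
  by congr (alpha _ ^+ _); lia.
rewrite big_split_ord /=; congr (_ + _).
  rewrite mulr_sumr (reindex_inj rev_ord_inj); apply: eq_bigr => i _.
  rewrite /alphabet_prob /letter_neg /letter_val /= ifT; last by have := ltn_ord i; lia.
  rewrite /= mulr1 [(N - i.+1 < N)%N](_ : _ = true) ?mul1n; last first.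
    by have := ltn_ord i; lia.
  by congr (_ * beta _ ^+ _); have := ltn_ord i; lia.
rewrite (eq_bigr (fun=> (gamma / N%:R) ^+ m)) => [|i _].
  by rewrite sumr_const card_ord mulr_natl.
rewrite /alphabet_prob /letter_neg /letter_val /= ifF; last by lia.
rewrite ifT ?eqxx /=; last by have := ltn_ord i; lia.
by rewrite [(N + i < N)%N](_ : _ = false) ?mul1r //; lia.
Qed.

Hypothesis alpha0 : forall i, 0 <= alpha i.
Hypothesis beta0 : forall i, 0 <= beta i.
Hypothesis gamma0 : 0 <= gamma.

(** The partial sums increase, and they stay below 1 because a_i <= 1 gives a_i^m <= a_i. *)
Lemma cvg_series_exp (a : nat -> R) m : (0 < m)%N -> (forall i, 0 <= a i) ->
  (forall N, \sum_(i < N) a i <= 1) ->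
  (fun N => \sum_(i < N.+1) a i ^+ m) @ \oo --> real_series_sum (fun i => a i ^+ m).
Proof.
move=> m0 a0 a1; rewrite /real_series_sum.
have -> : (fun N => \sum_(i < N.+1) a i ^+ m)
    = (fun N => series (fun i => a i ^+ m) N.+1).
  by apply/funext => N; rewrite /series /= big_mkord.
rewrite (cvg_shiftS (series (fun i => a i ^+ m))).
apply: nondecreasing_is_cvgn.
  apply/nondecreasing_seqP => N; rewrite /series /= big_nat_recr //= lerDl.
  exact: exprn_ge0.
exists 1 => _ [N _ <-]; rewrite /series /= big_mkord.
apply: le_trans (a1 N); apply: ler_sum => i _; case: m m0 => // m _.
rewrite exprS ler_piMr // exprn_ile1 //.
by apply: le_trans (a1 i.+1); rewrite big_ord_recr lerDr sumr_ge0.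
Qed.

Hypothesis sum_le1 : forall N,
  \sum_(i < N) alpha i + gamma + \sum_(i < N) beta i <= 1.

(** The copies of the letter 0 add N (gamma / N)^m, which is gamma for m = 1 and tends to 0 for m >
    1; this is why gamma appears in the first power sum only. *)
Lemma cvg_signed_power_sum m : (0 < m)%N ->
  (fun N => signed_power_sum (@letter_neg N.+1)
     (@alphabet_prob R alpha beta gamma N.+1) m) @ \oo
  --> ext_power_sum alpha beta gamma m.
Proof.
move=> m0.
have a1 N : \sum_(i < N) alpha i <= 1.
  apply: le_trans (sum_le1 N); rewrite -addrA lerDl addr_ge0 // sumr_ge0 //.
have b1 N : \sum_(i < N) beta i <= 1.
  by apply: le_trans (sum_le1 N); rewrite lerDr addr_ge0 // sumr_ge0.
have ca := cvg_series_exp m0 alpha0 a1.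
have cb := cvg_series_exp m0 beta0 b1.
have cc : (fun N => N.+1%:R * (gamma / N.+1%:R) ^+ m) @ \oo
    --> (if m == 1%N then gamma else 0).
  rewrite (_ : (fun _ => _) = fun N => gamma ^+ m * harmonic N ^+ m.-1).
    rewrite (_ : (if _ then _ else _) = gamma ^+ m * 0 ^+ m.-1).
      by apply: cvgM; [exact: cvg_cst | exact/cvg_seq_exp/cvg_harmonic].
    by case: m m0 {ca cb} => [|[|m]] //= _; rewrite ?mulr1 // expr0n /= mulr0.
  apply/funext => N; case: m m0 {ca cb} => // m _.
  rewrite expr_div_n [N.+1%:R ^+ _]exprS invfM mulrCA; congr (_ * _).
  by rewrite mulrA mulfV ?mul1r ?exprVn // pnatr_eq0.
rewrite (_ : ext_power_sum _ _ _ _ = real_series_sum (fun i => alpha i ^+ m)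
    + (-1) ^+ m.+1 * real_series_sum (fun i => beta i ^+ m)
    + (if m == 1%N then gamma else 0)); last first.
  rewrite /ext_power_sum; case: eqP => [->|_]; last by rewrite addr0.
  have e1 (a : nat -> R) : (fun i => a i ^+ 1) = a by apply/funext => i; rewrite expr1.
  by rewrite !e1 -signr_odd mul1r; ring.
rewrite (_ : (fun _ => _) = fun N => \sum_(i < N.+1) alpha i ^+ m
    + (-1) ^+ m.+1 * \sum_(i < N.+1) beta i ^+ m + N.+1%:R * (gamma / N.+1%:R) ^+ m).
  by apply: cvgD => //; apply: cvgD => //; apply: cvgM => //; exact: cvg_cst.
by apply/funext => N; rewrite signed_power_sum_alphabet.
Qed.

End PowerSumLimit.

(** * The recursion for shuffles *)

Section ShuffleRec.
Local Open Scope classical_set_scope.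
Variables (R : realType) (alpha beta : nat -> R) (gamma : R).
Hypothesis alpha0 : forall i, 0 <= alpha i.
Hypothesis beta0 : forall i, 0 <= beta i.
Hypothesis gamma0 : 0 <= gamma.
Hypothesis sum_le1 : forall N,
  \sum_(i < N) alpha i + gamma + \sum_(i < N) beta i <= 1.

Let neg N := @letter_neg N.+1.
Let y N := @alphabet_prob R alpha beta gamma N.+1.
Let P N := signed_power_sum (@neg N) (@y N).
Let X := xvar R.
Let G := coefs (cycle_series alpha beta gamma).
Let GN N := std_mean X (@neg N) (@y N).

Lemma mcoeff_scale (c : R) (p : xpoly R) M : mcoeff M (c *: p) = c * mcoeff M p.
Proof. exact: mcoeffZ. Qed.

Lemma mcoeff_sumZ (I : Type) (r : seq I) (c : I -> R) (B : I -> xpoly R) M :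
  mcoeff M (\sum_(i <- r) c i *: B i) = \sum_(i <- r) c i * mcoeff M (B i).
Proof. by rewrite raddf_sum; apply: eq_bigr => i _; exact: mcoeff_scale. Qed.

Lemma coefs_cycle_seriesE n :
  G n = \sum_(pi : 'S_n) shuffle_prob alpha beta gamma pi *: cycle_monom R pi.
Proof. by []. Qed.

Lemma std_mean_cycle_monom N n : GN N n
  = \sum_(pi : 'S_n) std_weight (@neg N) (@y N) pi *: cycle_monom R pi.
Proof. by []. Qed.

(** Limits are taken for each monomial M in the x_i separately: the polynomials are combinations of
    the same [cycle_monom] with convergent real weights. *)
Lemma cvg_mcoeff_std_mean M n :
  (fun N => mcoeff M (GN N n)) @ \oo --> mcoeff M (G n).
Proof.
rewrite coefs_cycle_seriesE.
rewrite [X in _ --> X]mcoeff_sumZ.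
rewrite (_ : (fun _ => _) = fun N => \sum_(pi : 'S_n)
    std_weight (@neg N) (@y N) pi * mcoeff M (cycle_monom R pi)); last first.
  by apply/funext => N; rewrite std_mean_cycle_monom mcoeff_sumZ.
apply: cvg_seq_sum => pi _; apply: cvgM; last exact: cvg_cst.
exact: cvg_std_weight.
Qed.

Lemma cvg_cycle_coef i j : (0 < i)%N -> (0 < j)%N ->
  (fun N => cycle_coef (P N) i j) @ \oo
    --> cycle_coef (ext_power_sum alpha beta gamma) i j.
Proof.
move=> i0 j0; apply: cvg_seq_sum => d; rewrite -dvdn_divisors // => di.
apply: cvgM; first exact: cvg_cst.
by apply: cvg_seq_exp; apply: cvg_signed_power_sum; rewrite // muln_gt0 j0 (dvdn_gt0 i0 di).
Qed.

Lemma cvg_mcoeff_log_coef M l n : (0 < l)%N ->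
  (fun N => mcoeff M (log_coef X (P N) l * GN N n)) @ \oo
    --> mcoeff M (log_coef X (ext_power_sum alpha beta gamma) l * G n).
Proof.
move=> l0; pose B i (pi : 'S_n) := X i ^+ (l %/ i) * cycle_monom R pi.
(* The scalars are moved in front of polynomials independent of N, so that only products of
   convergent real sequences remain. *)
have E (Q : nat -> R) (s : 'S_n -> R) :
    mcoeff M (log_coef X Q l * \sum_(pi : 'S_n) s pi *: cycle_monom R pi)
    = \sum_(i <- divisors l) \sum_(pi : 'S_n)
        cycle_coef Q i (l %/ i) * s pi * mcoeff M (B i pi).
  rewrite /log_coef mulr_suml raddf_sum; apply: eq_bigr => i _ /=.
  rewrite mulr_sumr raddf_sum; apply: eq_bigr => pi _ /=.
  by rewrite -scalerAl -scalerAr scalerA mcoeff_scale.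
rewrite coefs_cycle_seriesE [X in _ --> X]E.
rewrite (_ : (fun _ => _) = fun N =>
  \sum_(i <- divisors l) \sum_(pi : 'S_n) cycle_coef (P N) i (l %/ i)
    * std_weight (@neg N) (@y N) pi * mcoeff M (B i pi)); last first.
  by apply/funext => N; exact: (E (P N) (fun pi => std_weight (@neg N) (@y N) pi)).
apply: cvg_seq_sum => i; rewrite -dvdn_divisors // => il.
have i0 := dvdn_gt0 l0 il.
apply: cvg_seq_sum => pi _; apply: cvgM; last exact: cvg_cst.
apply: cvgM; last exact: cvg_std_weight.
by apply: cvg_cycle_coef; rewrite // divn_gt0 // dvdn_leq.
Qed.

Lemma cycle_series0 : G 0%N = 1.
Proof.
apply/malgP => M; have := @cvg_mcoeff_std_mean M 0.
rewrite (_ : (fun _ => _) = fun=> mcoeff M (1 : xpoly R)); last first.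
  by apply/funext => N; rewrite /GN std_mean0.
by move=> /cvg_lim <- //; rewrite lim_cst.
Qed.

Lemma cycle_series_rec n :
  G n *+ n = \sum_(l < n)
    log_coef X (ext_power_sum alpha beta gamma) l.+1 * G (n - l.+1)%N.
Proof.
apply/malgP => M.
have mcoeff_mulrn (p : xpoly R) : mcoeff M (p *+ n) = n%:R * mcoeff M p.
  have -> : p *+ n = (n%:R : R) *: p by rewrite scaler_nat.
  exact: mcoeff_scale.
have lhs : (fun N => n%:R * mcoeff M (GN N n)) @ \oo --> n%:R * mcoeff M (G n).
  by apply: cvgM; [exact: cvg_cst | exact: cvg_mcoeff_std_mean].
have rhs : (fun N => \sum_(l < n) mcoeff M (log_coef X (P N) l.+1 * GN N (n - l.+1)%N))
    @ \oo --> \sum_(l < n) mcoeff M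
      (log_coef X (ext_power_sum alpha beta gamma) l.+1 * G (n - l.+1)%N).
  by apply: cvg_seq_sum => l _; apply: cvg_mcoeff_log_coef.
have E : (fun N => n%:R * mcoeff M (GN N n)) = fun N => \sum_(l < n)
    mcoeff M (log_coef X (P N) l.+1 * GN N (n - l.+1)%N).
  apply/funext => N; rewrite -mcoeff_mulrn /GN std_mean_rec.
  exact: (raddf_sum (mcoeff M)).
rewrite E in lhs; rewrite mcoeff_mulrn [RHS](raddf_sum (mcoeff M)).
have <- := cvg_lim (@Rhausdorff R) lhs.
exact: (cvg_lim (@Rhausdorff R) rhs).
Qed.

End ShuffleRec.

(** * The product of exponentials *)

Lemma sum_factor_pairs (V : nmodType) (F : nat -> nat -> V) n
    (s : {fset nat * nat}) l :
  (forall ij : nat * nat, (ij.1 < n)%N -> (ij.2 < n)%N -> ij \in s) ->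
  (0 < l <= n)%N ->
  \sum_(ij <- s) F ij.1.+1 ij.2.+1 *+ (l == ij.1.+1 * ij.2.+1)%N
  = \sum_(i <- divisors l) F i (l %/ i)%N.
Proof.
move=> sn /andP[l0 ln].
transitivity (\sum_(ij <- [seq ij <- s | l == (ij.1.+1 * ij.2.+1)%N])
    F ij.1.+1 ij.2.+1).
  by rewrite big_filter [RHS]big_mkcond; apply: eq_bigr => ij _ /=; case: ifP.
(* A pair with product l has both entries at most l <= n, so s contains its index; the predecessors
   undo the shift by one of the indices. *)
rewrite (perm_big [seq (i.-1, (l %/ i).-1) | i <- divisors l]) /=.
  rewrite big_map; apply: eq_big_seq => i; rewrite -dvdn_divisors // => il /=.
  have i0 := dvdn_gt0 l0 il.
  by rewrite !prednK // divn_gt0 // dvdn_leq.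
apply: uniq_perm.
- by rewrite filter_uniq // fset_uniq.
- rewrite map_inj_in_uniq ?divisors_uniq // => i i'.
  rewrite -!dvdn_divisors // => /(dvdn_gt0 l0) i0 /(dvdn_gt0 l0) i'0 [ii' _].
  by rewrite -(prednK i0) ii' prednK.
move=> [i j]; rewrite mem_filter /=; apply/andP/mapP => [[/eqP lE _]|[e]].
  exists i.+1; first by rewrite -dvdn_divisors // lE dvdn_mulr.
  by rewrite lE mulKn.
rewrite -dvdn_divisors // => el [-> ->]; have e0 := dvdn_gt0 l0 el.
have le0 : (0 < l %/ e)%N by rewrite divn_gt0 // dvdn_leq.
rewrite !prednK // mulnC divnK //; split=> //; apply: sn => /=.
  by rewrite prednK // (leq_trans _ ln) // dvdn_leq.
by rewrite prednK // (leq_trans (leq_div _ _)).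
Qed.

Section ProductSide.
Variables (R : realType) (alpha beta : nat -> R) (gamma : R).
Let cc := cycle_coef (ext_power_sum alpha beta gamma).
Let X := xvar R.

Lemma fps_theta_cycle_factor i j : (0 < i)%N -> (0 < j)%N ->
  fps_theta (cycle_factor alpha beta gamma i j)
  = cycle_factor alpha beta gamma i j * fps_mono (i * j) (cc i j *: X i ^+ j).
Proof.
by move=> i0 j0; apply: fps_theta_exp_fpsX_fpsC.
Qed.

Lemma coefs_sum_cycle_log n (s : {fset nat * nat}) l :
  (forall ij : nat * nat, (ij.1 < n)%N -> (ij.2 < n)%N -> ij \in s) ->
  (0 < l <= n)%N ->
  coefs (\sum_(ij <- s) fps_mono (ij.1.+1 * ij.2.+1)
     (cc ij.1.+1 ij.2.+1 *: X ij.1.+1 ^+ ij.2.+1)) l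
  = log_coef X (ext_power_sum alpha beta gamma) l.
Proof.
move=> sn ln; rewrite coefs_sum.
exact: (sum_factor_pairs (fun i j => cc i j *: X i ^+ j) sn ln).
Qed.

End ProductSide.

(** * Reversing the deck *)

Section Reversal.
Variable n : nat.
Implicit Types (w : {ffun 'I_n -> int}) (pi : 'S_n).

Definition opp_word w : {ffun 'I_n -> int} := [ffun k => - w k].

Lemma opp_wordK : involutive opp_word.
Proof. by move=> w; apply/ffunP => k; rewrite !ffunE opprK. Qed.

Lemma longest_permK pi : (pi * longest_perm n * longest_perm n)%g = pi.
Proof. by apply/permP => k; rewrite !permM !permE rev_ordK. Qed.

Lemma reversed_lt pi k l :
  ((pi * longest_perm n)%g k < (pi * longest_perm n)%g l)%N = (pi l < pi k)%N.
Proof.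
rewrite !permM !permE /=; have := ltn_ord (pi k); have := ltn_ord (pi l).
by move: (pi k : nat) (pi l : nat) => a b; lia.
Qed.

(** Negating the letters reverses the order of the blocks and the direction inside the blocks of
    nonzero letters, as does reversing the values of pi. *)
Lemma blocks_reversed w pi :
  in_blocks (opp_word w) (pi * longest_perm n)%g
    && ordered_in_blocks (opp_word w) (pi * longest_perm n)%g
  = in_blocks w pi && ordered_in_blocks w pi.
Proof.
(* One implication is enough, since both reversals are involutions. *)
have imp w1 pi1 : in_blocks w1 pi1 && ordered_in_blocks w1 pi1 ->
    in_blocks (opp_word w1) (pi1 * longest_perm n)%g
      && ordered_in_blocks (opp_word w1) (pi1 * longest_perm n)%g.
  case/andP=> /in_blocksP b /ordered_in_blocksP o; apply/andP; split.
    by apply/in_blocksP => k l; rewrite !ffunE ltrN2 reversed_lt => /b.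
  apply/ordered_in_blocksP => k l kl; rewrite !ffunE => /oppr_inj wkl.
  by rewrite oppr_gt0 oppr_lt0 !reversed_lt; have [h1 h2] := o k l kl wkl.
apply/idP/idP => [h|]; last exact: imp.
by have := imp _ _ h; rewrite opp_wordK longest_permK.
Qed.

Variables (R : realType) (alpha beta : nat -> R) (gamma : R).

Lemma fill_prob_reversed w pi :
  fill_prob R (opp_word w) (pi * longest_perm n)%g = fill_prob R w pi.
Proof.
rewrite /fill_prob blocks_reversed; case: ifP => // _; congr (_`!%:R^-1).
by apply: eq_card => k; rewrite !inE ffunE oppr_eq0.
Qed.

Lemma word_prob_opp w :
  word_prob alpha beta gamma (opp_word w) = word_prob beta alpha gamma w.
Proof.
by apply: eq_bigr => k _; rewrite ffunE; case: (w k) => [[|i]|i].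
Qed.

(** Negation permutes the words and exchanges the roles of alpha and beta. *)
Lemma shuffle_prob_reversed pi :
  shuffle_prob alpha beta gamma (pi * longest_perm n)%g
  = shuffle_prob beta alpha gamma pi.
Proof.
rewrite /shuffle_prob; congr fine.
rewrite (reindex_esum [set: {ffun 'I_n -> int}]%classic
  [set: {ffun 'I_n -> int}]%classic opp_word).
  by apply: eq_esum => w _; rewrite word_prob_opp fill_prob_reversed.
split=> //; first by move=> w w' _ _; apply: (can_inj opp_wordK).
by move=> w _; exists (opp_word w); rewrite ?opp_wordK.
Qed.

Lemma reversed_shuffle_meanE (V : lmodType R) (f : 'S_n -> V) :
  reversed_shuffle_mean alpha beta gamma f = shuffle_mean beta alpha gamma f.
Proof.
rewrite /reversed_shuffle_mean /shuffle_mean.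
rewrite (reindex_inj (mulIg (longest_perm n))) /=.
by apply: eq_bigr => pi _; rewrite longest_permK shuffle_prob_reversed.
Qed.

End Reversal.

Lemma sum_le1_of_esum (R : realType) (alpha beta : nat -> R) (gamma : R)
    (halpha : forall i, 0 <= alpha i) (hbeta : forall i, 0 <= beta i)
    (hsum : (gamma%:E + \sum_(0 <= i <oo) (alpha i)%:E
             + \sum_(0 <= i <oo) (beta i)%:E = 1)%E) N :
  \sum_(i < N) alpha i + gamma + \sum_(i < N) beta i <= 1.
Proof.
rewrite -lee_fin -hsum !EFinD -!sumEFin [X in (X + _ <= _)%E]addeC.
by apply: leeD; [apply: leeD => // |]; rewrite -(big_mkord xpredT (fun i => (_ i)%:E));
  apply: nneseries_lim_ge => i _ _; rewrite lee_fin.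
Qed.

Theorem theorem9 (R : realType) (alpha beta : nat -> R) (gamma : R)
    (halpha : forall i, 0 <= alpha i) (hbeta : forall i, 0 <= beta i)
    (hgamma : 0 <= gamma)
    (hsum : (gamma%:E + \sum_(0 <= i <oo) (alpha i)%:E
             + \sum_(0 <= i <oo) (beta i)%:E = 1)%E) :
  is_fps_prod
    (fun ij : nat * nat => cycle_factor alpha beta gamma ij.1.+1 ij.2.+1)
    (cycle_series alpha beta gamma)
  /\ reversed_cycle_series alpha beta gamma = cycle_series beta alpha gamma.
Proof.
have sum_le1 := sum_le1_of_esum halpha hbeta hsum.
split; last by apply/fpsP => n; apply: reversed_shuffle_meanE.
(* Only the factors with i j <= n affect degrees up to n; after the shift by one their indices are
   both below n. *)
move=> n; exists [fset ij in [seq (i, j) | i <- iota 0 n, j <- iota 0 n]]%fset.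
move=> s /fsubsetP s0s.
have sn (ij : nat * nat) : (ij.1 < n)%N -> (ij.2 < n)%N -> ij \in s.
  move=> i1 i2; apply: s0s; rewrite inE; apply/allpairsP; exists ij.
  by rewrite !mem_iota /= !add0n -surjective_pairing.
set F := \prod_(_ <- _) _.
have thF : fps_theta F = F * \sum_(ij <- s) fps_mono (ij.1.+1 * ij.2.+1)
    (cycle_coef (ext_power_sum alpha beta gamma) ij.1.+1 ij.2.+1
       *: xvar R ij.1.+1 ^+ ij.2.+1).
  by apply: fps_theta_prod => ij _; apply: fps_theta_cycle_factor.
have F0 : coefs F 0 = 1.
  by rewrite coefs0_prod big1 // => ij _; apply: coefs0_exp.
(* The finite product and the shuffle series have constant term 1 and obey the same recursion up to
   degree n. *)
apply: (@coefs_rec_unique _ _ (coefs F) (coefs (cycle_series alpha beta gamma))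
  (log_coef (xvar R) (ext_power_sum alpha beta gamma)) n) => // [|k kn|k kn].
- by rewrite F0 cycle_series0.
- rewrite (coefs_theta_rec _ thF); last first.
    by rewrite coefs_sum big1.
  apply: eq_bigr => l _; congr (_ * _).
  by apply: (coefs_sum_cycle_log _ _ _ sn); rewrite /= (leq_trans _ kn).
- exact: cycle_series_rec.
Qed.
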